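(* The $\mathbb{Q}$-linear map $\mathfrak{g}^{\mathrm{sh}}:\mathcal{I}^1_\bullet\to\mathbb{C}[[q]]$ is an algebra homomorphism, where $\mathcal{I}^1_\bullet$ carries the shuffle product.
   Context: Let $\mathcal{I}_\bullet$ be the $\mathbb{Q}$-vector space spanned by symbols $\mathbb{I}(a_0;a_1,\ldots,a_N;a_{N+1})$ ($N\ge 0$, $a_i\in\{0,1\}$) subject to: (I1) $\mathbb{I}(a;\emptyset;b)=1$; (I2) the product is the shuffle product: $\mathbb{I}(a_0;a_1,\ldots,a_N;a_{N+N'+1})\,\mathbb{I}(a_0;a_{N+1},\ldots,a_{N+N'};a_{N+N'+1})=\sum_{\sigma\in\Sigma(N,N')}\mathbb{I}(a_0;a_{\sigma^{-1}(1)},\ldots,a_{\sigma^{-1}(N+N')};a_{N+N'+1})$, $\Sigma(N,N')$ being the $\sigma\in\mathfrak{S}_{N+N'}$ with $\sigma(1)<\cdots<\sigma(N)$, $\sigma(N+1)<\cdots<\sigma(N+N')$; (I3) for $x\in\{0,1\}$, $\mathbb{I}(a_0;a_1,\ldots,a_N;a_{N+1})=\sum_{k=0}^N\mathbb{I}(a_0;a_1,\ldots,a_k;x)\mathbb{I}(x;a_{k+1},\ldots,a_N;a_{N+1})$; (I4) $\mathbb{I}(a;a_1,\ldots,a_N;a)=0$ for $N\ge1$. This is a commutative $\mathbb{Q}$-algebra. Let $\mathcal{I}^1_\bullet=\mathcal{I}_\bullet/\mathbb{I}(0;0;1)\mathcal{I}_\bullet$, $I(\cdots)$ the images, and $I(n_1,\ldots,n_r)=I(0;1,0^{n_1-1},\ldots,1,0^{n_r-1};1)$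 ($n_i\ge1$, $0^m$ = $m$ zeros), $I()=1$; these form a $\mathbb{Q}$-basis of $\mathcal{I}^1_\bullet$. For positive integers $n_i$ and variables $x_i$ let $H\binom{n_1,\ldots,n_r}{x_1,\ldots,x_r}=\sum_{0<u_1<\cdots<u_r}\prod_{j=1}^re^{u_jx_j}\big(\frac{q^{u_j}}{1-q^{u_j}}\big)^{n_j}\in\mathbb{Q}[[q]][[x_1,\ldots,x_r]]$. Let $h(x_1,\ldots,x_r)=\sum_{(i_1,\ldots,i_m)}\frac{1}{i_1!\cdots i_m!}H\binom{i_1,\ldots,i_m}{y_1,\ldots,y_m}$ over all compositions $i_1+\cdots+i_m=r$ ($i_j\ge1$), with $y_1=x_1+\cdots+x_{i_1}$, $y_2=x_{i_1+1}+\cdots+x_{i_1+i_2}$, ..., $y_m=x_{i_1+\cdots+i_{m-1}+1}+\cdots+x_r$. Let $g_{\mathrm{sh}}(x_1,\ldots,x_r)=h(x_r-x_{r-1},\ldots,x_2-x_1,x_1)$, and let $g^{\mathrm{sh}}_{n_1,\ldots,n_r}(q)$ be the coefficient of $x_1^{n_1-1}\cdots x_r^{n_r-1}$ in $g_{\mathrm{sh}}(-2\pi\sqrt{-1}x_1,\ldots,-2\pi\sqrt{-1}x_r)$. Define $\mathfrak{g}^{\mathrm{sh}}$ $\mathbb{Q}$-linearly by $\mathfrak{g}^{\mathrm{sh}}(I(n_1,\ldots,n_r))=g^{\mathrm{sh}}_{n_1,\ldots,n_r}(q)$ and $\mathfrak{g}^{\mathrm{sh}}(1)=1$. *)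

(* Defs.v *)
From HB Require Import structures.
From mathcomp Require Import all_boot all_order all_algebra perm.
From mathcomp Require Import generic_quotient ring_quotient.
From mathcomp Require Import -(notations) monalg.
From mathcomp Require Import mpoly complex boolp reals.
From mathcomp Require finmap trigo.

Set Implicit Arguments.
Unset Strict Implicit.
Unset Printing Implicit Defensive.

Import GRing.Theory Num.Theory.
Local Open Scope ring_scope.
Local Open Scope quotient_scope.

(* ------------------------------------------------------------------------ *)
(* The quotient of a commutative algebra by an ideal is again an algebra.    *)

Section QuotientAlgebra.
Variables (K : comNzRingType) (A : comAlgType K) (J : idealr A).
Local Notation Q := (@Quotient.quot A J).

Definition qscale (c : K) (x : Q) : Q := \pi_Q (c%:A) * x.

Lemma pi_algM (c d : K) : \pi_Q (c * d)%:A = \pi_Q c%:A * \pi_Q d%:A :> Q.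
Proof. by rewrite -rmorphM /= mulr_algl scalerA. Qed.

Fact qscaleA a b v : qscale a (qscale b v) = qscale (a * b) v.
Proof. by rewrite /qscale pi_algM mulrA. Qed.

Fact qscale1 : left_id 1 qscale.
Proof. by move=> x; rewrite /qscale scale1r rmorph1 mul1r. Qed.

Fact qscaleDr : right_distributive qscale +%R.
Proof. by move=> c x y; rewrite /qscale mulrDr. Qed.

Fact qscaleDl v : {morph qscale^~ v : a b / a + b}.
Proof. by move=> a b; rewrite /qscale scalerDl rmorphD mulrDl. Qed.

HB.instance Definition _ := GRing.Zmodule_isLmodule.Build K Q
  qscaleA qscale1 qscaleDr qscaleDl.

Fact qscaleAl (c : K) (u v : Q) : c *: (u * v) = (c *: u) * v.
Proof. exact: mulrA. Qed.

HB.instance Definition _ := GRing.Lmodule_isLalgebra.Build K Q qscaleAl.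
HB.instance Definition _ := GRing.Lalgebra_isComAlgebra.Build K Q.

End QuotientAlgebra.

(* The ideal generated by S. *)
Definition ideal_gen (A : comNzRingType) (S : A -> Prop) : {pred A} :=
  fun x => `[< exists2 t : seq (A * A),
    (forall p, p \in t -> S p.2) & x = \sum_(p <- t) p.1 * p.2 >].

Lemma ideal_gen_closed (A : comNzRingType) (S : A -> Prop) :
  1 \notin ideal_gen S -> idealr_closed (ideal_gen S).
Proof.
move=> N1; split=> //.
  by apply/asboolP; exists [::]; rewrite ?big_nil.
move=> a u v /asboolP[s Ss ->] /asboolP[t St ->]; apply/asboolP.
exists ([seq (a * p.1, p.2) | p <- s] ++ t).
  by move=> p; rewrite mem_cat => /orP[/mapP[p' /Ss ? ->]|/St].
rewrite big_cat big_map mulr_sumr; congr (_ + _).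
by apply: eq_bigr => p _; rewrite mulrA.
Qed.

(* ------------------------------------------------------------------------ *)
(* Formal iterated integrals.  The letters 0 and 1 are false and true, and   *)
(* (a, w, b) stands for the symbol I(a; w; b).                               *)

Notation isym := (bool * seq bool * bool)%type.

(* The free commutative Q-algebra on the symbols. *)
Notation Ifree := (malg (cmonom isym) rat).

(* Locked because the comparison of a symbol with 1 by unfolding diverges.    *)
HB.lock Definition Isym (a : bool) (w : seq bool) (b : bool) : Ifree :=
  monalg.mkmalgU (monalg.ucm ((a, w, b) : isym)) 1.

(* Sigma(N, N') *)
Definition shuffle_perms (N N' : nat) : {set 'S_(N + N')} :=
  [set s : 'S_(N + N') |
    [forall i : 'I_N, forall j : 'I_N,
       (i < j)%N ==> (s (lshift N' i) < s (lshift N' j))%N]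
    && [forall i : 'I_N', forall j : 'I_N',
       (i < j)%N ==> (s (rshift N i) < s (rshift N j))%N]].

Inductive Irel : Ifree -> Prop :=
| Irel1 (a b : bool) : Irel (Isym a [::] b - 1)
| Irel2 (N N' : nat) (a b : bool) (u : N.-tuple bool) (v : N'.-tuple bool) :
    Irel (Isym a u b * Isym a v b
          - \sum_(s in shuffle_perms N N')
              Isym a [seq tnth (cat_tuple u v) ((s^-1)%g i)
                     | i <- enum 'I_(N + N')] b)
| Irel3 (a b x : bool) (w : seq bool) :
    Irel (Isym a w b
          - \sum_(k < (size w).+1) Isym a (take k w) x * Isym x (drop k w) b)
| Irel4 (a : bool) (w : seq bool) : w != [::] -> Irel (Isym a w a).

(* The augmentation sending I(a; w; b) to 1 if w is empty and to 0 otherwise *)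
(* vanishes on the relations, so that the quotients below are not trivial.   *)

Definition epsm (m : cmonom isym) : rat :=
  (all (fun i : isym => nilp i.1.2) (finmap.enum_fset (finmap.finsupp m)))%:R.

Fact epsm_morph : mmorphism epsm.
Proof.
split=> [x y|]; rewrite /epsm ?mdom1 //.
rewrite mdomD -natrM mulnb; congr ((nat_of_bool _)%:R).
apply/allP/andP => [h|[/allP hx /allP hy] z].
  by split; apply/allP => z zx; apply: h; rewrite finmap.in_fsetE zx ?orbT.
by rewrite finmap.in_fsetE => /orP[/hx|/hy].
Qed.

HB.instance Definition _ :=
  isMultiplicative.Build (cmonom isym) rat epsm epsm_morph.

Lemma augmentation : {eps : {rmorphism Ifree -> rat} |
  forall a w b, eps (Isym a w b) = (nilp w)%:R}.
Proof.
exists (monalg.mmap idfun epsm) => a w b.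
rewrite Isym.unlock /= monalg.mmapU mul1r /epsm mdomU.
congr ((nat_of_bool _)%:R).
apply/allP/idP => [|wn z]; last by rewrite finmap.in_fsetE => /eqP->.
by move/(_ (a, w, b)); apply; rewrite finmap.in_fsetE.
Qed.

Definition eps : {rmorphism Ifree -> rat} := sval augmentation.

Lemma eps_Isym a w b : eps (Isym a w b) = (nilp w)%:R.
Proof. exact: (svalP augmentation). Qed.

Lemma eps_Irel x : Irel x -> eps x = 0.
Proof.
case=> [a b|N N' a b u v|a b y w|a w wn]; last 1 first.
- by rewrite eps_Isym; case: w wn.
- by rewrite rmorphB rmorph1 eps_Isym subrr.
- rewrite rmorphB rmorphM rmorph_sum !eps_Isym /nilp !size_tuple.
  rewrite (eq_bigr (fun=> (N + N' == 0)%N%:R)) => [|s _]; last first.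
    by rewrite eps_Isym /nilp size_map size_enum_ord.
  apply/eqP; rewrite subr_eq0; apply/eqP.
  rewrite -natrM mulnb addn_eq0.
  case: (altP andP) => [[/eqP N0 /eqP N'0]|_]; last by rewrite big1.
  subst N N'; rewrite (big_pred1 (1%g : 'S_(0 + 0))) // => s; rewrite inE.
  rewrite (_ : s = 1%g);
    last by apply/permP; case.
  rewrite [RHS]eqxx.
  by apply/andP; split; apply/fintype.forallP; case.
- rewrite rmorphB rmorph_sum eps_Isym.
  pose F k : rat := (nilp (take k w))%:R * (nilp (drop k w))%:R.
  rewrite (eq_bigr (fun k : 'I_(size w).+1 => F k)) => [|k _]; last first.
    by rewrite rmorphM !eps_Isym.
  rewrite big_ord_recl /F /= take0 drop0 mul1r big1 ?addr0 ?subrr // => k _.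
  by case: w k {F} => [|c w] [k ltk] //=; rewrite mul0r.
Qed.

Fact Iideal_proper : 1 \notin ideal_gen Irel.
Proof.
apply/asboolP => -[t tI /(congr1 eps)]; rewrite rmorph1 rmorph_sum big1_seq.
  by move/eqP; rewrite oner_eq0.
by move=> p /andP[_ /tI/eps_Irel e0]; rewrite rmorphM [X in _ * X]e0 mulr0.
Qed.

Definition Iideal : {pred Ifree} := ideal_gen Irel.
HB.instance Definition _ :=
  isIdealr.Build Ifree Iideal (ideal_gen_closed Iideal_proper).

(* I_bullet *)
Definition Ialg : Type := @Quotient.quot Ifree Iideal.
HB.instance Definition _ := GRing.ComAlgebra.on Ialg.

Definition II (a : bool) (w : seq bool) (b : bool) : Ialg :=
  \pi_(@Quotient.quot Ifree Iideal) (Isym a w b).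

(* The principal ideal I(0; 0; 1) I_bullet. *)
Definition Iideal0 : {pred Ialg} :=
  fun x => `[< exists y, x = II false [:: false] true * y >].

Fact Iideal0_closed : idealr_closed Iideal0.
Proof.
split; first by apply/asboolP; exists 0; rewrite mulr0.
  apply/asboolP => -[y]; rewrite -[y]reprK /II => /eqP.
  rewrite -[1]/(1 : @Quotient.quot Ifree Iideal) -(rmorph1 \pi) -rmorphM.
  rewrite -subr_eq0 -rmorphB.
  rewrite -(rmorph0 \pi_(@Quotient.quot Ifree Iideal)) -Quotient.idealrBE subr0.
  move=> /asboolP[t tI /(congr1 eps)]; rewrite rmorphB rmorph1 rmorphM eps_Isym.
  rewrite mul0r subr0 rmorph_sum big1_seq; first by move/eqP; rewrite oner_eq0.
  by move=> p /andP[_ /tI/eps_Irel e0]; rewrite rmorphM [X in _ * X]e0 mulr0.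
move=> a u v /asboolP[y ->] /asboolP[z ->]; apply/asboolP; exists (a * y + z).
by rewrite mulrDr mulrCA.
Qed.

HB.instance Definition _ := isIdealr.Build Ialg Iideal0 Iideal0_closed.

(* I^1_bullet *)
Definition I1alg : Type := @Quotient.quot Ialg Iideal0.
HB.instance Definition _ := GRing.ComAlgebra.on I1alg.

Definition I1 (a : bool) (w : seq bool) (b : bool) : I1alg :=
  \pi_(@Quotient.quot Ialg Iideal0) (II a w b).

(* I(n_1, ..., n_r) *)
Definition Iidx (ns : seq nat) : I1alg :=
  I1 false (flatten [seq true :: nseq n.-1 false | n <- ns]) true.

(* ------------------------------------------------------------------------ *)
(* The ring R[[q]]; f m is the coefficient of q^m in f.                      *)

Definition fps (R : Type) : Type := nat -> R.
HB.instance Definition _ (R : Type) := gen_eqMixin (fps R).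
HB.instance Definition _ (R : Type) := gen_choiceMixin (fps R).

Section FormalPowerSeries.
Variable R : comNzRingType.
Implicit Types f g h : fps R.

Definition fps0 : fps R := fun=> 0.
Definition fps1 : fps R := fun m => (m == 0%N)%:R.
Definition fpsX : fps R := fun m => (m == 1%N)%:R.
Definition fps_opp f : fps R := fun m => - f m.
Definition fps_add f g : fps R := fun m => f m + g m.
Definition fps_mul f g : fps R := fun m => \sum_(k < m.+1) f k * g (m - k)%N.
Definition fps_scale (c : R) f : fps R := fun m => c * f m.

Fact fps_addA : associative fps_add.
Proof. by move=> f g h; apply/funext => m; rewrite /fps_add addrA. Qed.
Fact fps_addC : commutative fps_add.
Proof. by move=> f g; apply/funext => m; rewrite /fps_add addrC. Qed.
Fact fps_add0 : left_id fps0 fps_add.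
Proof. by move=> f; apply/funext => m; rewrite /fps_add add0r. Qed.
Fact fps_addN : left_inverse fps0 fps_opp fps_add.
Proof. by move=> f; apply/funext => m; rewrite /fps_add addNr. Qed.

HB.instance Definition _ := GRing.isZmodule.Build (fps R)
  fps_addA fps_addC fps_add0 fps_addN.

Let trunc N f : {poly R} := \poly_(i < N) f i.

Let fps_mulE N f g m : (m < N)%N -> fps_mul f g m = (trunc N f * trunc N g)`_m.
Proof.
move=> ltmN; rewrite coefM; apply: eq_bigr => k _.
have ltkN : (k < N)%N by rewrite (leq_ltn_trans _ ltmN) // -ltnS.
by rewrite !coef_poly ltkN (leq_ltn_trans (leq_subr k m) ltmN).
Qed.

Let trunc_mul N f g h m : (m < N)%N ->
  (trunc N (fps_mul f g) * trunc N h)`_m = (trunc N f * trunc N g * trunc N h)`_m.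
Proof.
move=> ltmN; rewrite !coefM; apply: eq_bigr => k _.
have ltkN : (k < N)%N by rewrite (leq_ltn_trans _ ltmN) // -ltnS.
by rewrite coef_poly ltkN (fps_mulE _ _ ltkN).
Qed.

Fact fps_mulC : commutative fps_mul.
Proof. by move=> f g; apply/funext => m; rewrite !(fps_mulE _ _ (ltnSn m)) mulrC. Qed.
Fact fps_mulA : associative fps_mul.
Proof.
move=> f g h; apply/funext => m.
rewrite (fps_mulC f) !(fps_mulE _ _ (ltnSn m)) !trunc_mul //.
by rewrite -[in RHS]mulrA [in RHS]mulrC.
Qed.
Fact fps_mul1 : left_id fps1 fps_mul.
Proof.
move=> f; apply/funext => m; rewrite /fps_mul big_ord_recl mul1r subn0.
by rewrite big1 ?addr0 // => i _; rewrite mul0r.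
Qed.
Fact fps_mulDl : left_distributive fps_mul fps_add.
Proof.
move=> f g h; apply/funext => m; rewrite /fps_mul /fps_add -big_split.
by apply: eq_bigr => k _; rewrite mulrDl.
Qed.
Fact fps1_neq0 : fps1 != 0.
Proof. by apply/eqP => /(congr1 (fun f => f 0)) /eqP; rewrite oner_eq0. Qed.

HB.instance Definition _ := GRing.Zmodule_isComNzRing.Build (fps R)
  fps_mulA fps_mulC fps_mul1 fps_mulDl fps1_neq0.

Fact fps_scaleA a b f : fps_scale a (fps_scale b f) = fps_scale (a * b) f.
Proof. by apply/funext => m; rewrite /fps_scale mulrA. Qed.
Fact fps_scale1 : left_id 1 fps_scale.
Proof. by move=> f; apply/funext => m; rewrite /fps_scale mul1r. Qed.
Fact fps_scaleDr : right_distributive fps_scale +%R.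
Proof. by move=> c f g; apply/funext => m; rewrite /fps_scale mulrDr. Qed.
Fact fps_scaleDl f : {morph fps_scale^~ f : a b / a + b}.
Proof. by move=> a b; apply/funext => m; rewrite /fps_scale mulrDl. Qed.

HB.instance Definition _ := GRing.Zmodule_isLmodule.Build R (fps R)
  fps_scaleA fps_scale1 fps_scaleDr fps_scaleDl.

Fact fps_scaleAl (c : R) f g : c *: (f * g) = (c *: f) * g.
Proof.
apply/funext => m; rewrite /GRing.scale /= /fps_scale mulr_sumr.
by apply: eq_bigr => k _; rewrite mulrA.
Qed.

HB.instance Definition _ := GRing.Lmodule_isLalgebra.Build R (fps R) fps_scaleAl.
HB.instance Definition _ := GRing.Lalgebra_isComAlgebra.Build R (fps R).

Definition fps_unit : {pred fps R} := fun f => `[< exists g, g * f = 1 >].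
Definition fps_inv f : fps R :=
  if pselect (exists g, g * f = 1) is left e then projT1 (cid e) else f.

Fact fps_mulVr : {in fps_unit, left_inverse 1 fps_inv *%R}.
Proof.
move=> f /asboolP e; rewrite /fps_inv; case: pselect => // e'.
exact: projT2 (cid e').
Qed.
Fact fps_unitP f g : g * f = 1 -> fps_unit f.
Proof. by move=> gf; apply/asboolP; exists g. Qed.
Fact fps_inv_out : {in [predC fps_unit], fps_inv =1 id}.
Proof.
move=> f /asboolP nf; rewrite /fps_inv; case: pselect => // e.
Qed.

HB.instance Definition _ := GRing.ComNzRing_hasMulInverse.Build (fps R)
  fps_mulVr fps_unitP fps_inv_out.

End FormalPowerSeries.

Arguments fpsX {R}.

Definition fps_map (R S : Type) (phi : R -> S) (f : fps R) : fps S :=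
  fun m => phi (f m).

(* ------------------------------------------------------------------------ *)
(* A[[x_1, ..., x_r]] as a mere set of coefficient families.                 *)

Definition mps (A : Type) (r : nat) : Type := 'X_{1..r} -> A.

(* f(L_1, ..., L_s) for polynomials L_j without constant term.  The          *)
(* coefficient of x^a only involves the terms of f of degree at most |a|.    *)
Definition msubst (K : comNzRingType) (A : lmodType K) (s r : nat)
    (L : 'I_s -> {mpoly K[r]}) (f : mps A s) : mps A r :=
  fun a => \sum_(b : 'X_{1..s < (mdeg a).+1})
             (\prod_(j < s) L j ^+ b j)@_a *: f b.

(* The coefficient of x^k in e^(c x). *)
Definition exp_coef (c : rat) (k : nat) : rat := c ^+ k / k`!%:R.

(* The term of index u is divisible by q^(u_r), so that only the tuples with *)
(* entries at most m contribute to the coefficient of q^m; the coefficient   *)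
(* of x^a in the product of the e^(u_j x_j) is the product of exp_coef.      *)
Definition Hser (r : nat) (n : 'I_r -> nat) : mps (fps rat) r :=
  fun a => (fun m =>
    (\sum_(u : {ffun 'I_r -> 'I_m.+1} |
            [forall i, (0 < u i)%N]
            && [forall i : 'I_r, forall j : 'I_r, (i < j)%N ==> (u i < u j)%N])
       \prod_(j < r) (exp_coef (u j)%:R (a j)
                      *: (fpsX ^+ u j / (1 - fpsX ^+ u j)) ^+ n j)) m).

(* The sum over the compositions (i_1, ..., i_m) of r; necessarily m <= r    *)
(* and i_j <= r.                                                             *)
Definition hser (r : nat) : mps (fps rat) r :=
  fun a => \sum_(m < r.+1)
    \sum_(i : {ffun 'I_m -> 'I_r.+1} |
            [forall j, (0 < i j)%N] && (\sum_j i j == r)%N)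
      (\prod_(j < m) ((i j)`!%:R : rat))^-1
        *: msubst (fun j : 'I_m =>
             \sum_(k < r | (\sum_(l < m | l < j) i l <= k
                            < \sum_(l < m | l <= j) i l)%N) 'X_k)
             (Hser (fun j => i j : nat)) a.

(* The j-th argument, counted from 0, is x_(r-j) - x_(r-j-1) in the          *)
(* numbering x_1, ..., x_r, the second term being absent if j = r - 1.       *)
Definition gsh_gen (r : nat) : mps (fps rat) r :=
  msubst (fun j : 'I_r =>
            'X_(rev_ord j) - \sum_(k < r | k.+1 == rev_ord j) 'X_k)
         (@hser r).

Definition gsh_coef (R : realType) (ns : seq nat) : fps R[i] :=
  msubst (fun j : 'I_(size ns) => ((- 2 * @trigo.pi R)%:C * 'i)%C *: 'X_j)
         (fun a => fps_map ratr (@gsh_gen (size ns) a))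
         [multinom (nth 0%N ns j).-1 | j < size ns].

(* g sends every I(n_1, ..., n_r) to g^sh_(n_1, ..., n_r)(q). *)
Definition gsh_values (R : realType) (g : I1alg -> fps R[i]) : Prop :=
  forall ns : seq nat, all (fun n => 0 < n)%N ns -> g (Iidx ns) = gsh_coef R ns.

(* Main.v *)
From HB Require Import structures.
Require Import Defs.
From mathcomp Require Import all_boot all_order all_algebra perm.
From mathcomp Require Import generic_quotient ring_quotient.
From mathcomp Require Import -(notations) finmap monalg.
From mathcomp Require Import complex boolp reals ring.
From mathcomp Require trigo.

(** A shuffle character chi on words in the letters e_0 = false and e_1 = true
    (a group-like noncommutative power series) extends to a homomorphism on
    I_bullet by I(0; w; 1) |-> chi w, I(1; w; 0) |-> chi^-1 w and
    I(a; w; a) |-> 0 for w nonempty; it descends to I^1_bullet if chi e_0 = 0.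
    With t_u = q^u / (1 - q^u) and c = -2 pi i, take for chi the limit of
      W_M = prod_(u = M, ..., 1) e^(- c u e_0) exp (t_u e_1) e^(c u e_0),
    which is group-like as a product of exponentials, and converges because
    t_u = O(q^u).  The inner exponentials telescope to e^(c e_0), so the
    coefficient of e_1 e_0^(a_1) ... e_1 e_0^(a_r) in W_M is the sum over
    M >= u_1 >= ... >= u_r >= 1 of the product of the t_(u_j), of the 1/i! for
    the multiplicities i, and of the (c (u_j - u_(j+1)))^(a_j) / a_j!, where
    u_(r+1) = 0.  The multiplicities give the sum over compositions defining h,
    and the differences u_j - u_(j+1) come from the substitution
    h(x_r - x_(r-1), ..., x_2 - x_1, x_1), so this is g^sh.
    Uniqueness holds because the I(n_1, ..., n_r) span I^1_bullet: shuffling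
    with I(0; 0; 1) = 0 removes the leading zeros of a word. *)

Set Implicit Arguments.
Unset Strict Implicit.
Unset Printing Implicit Defensive.

Import GRing.Theory Num.Theory.
Local Open Scope ring_scope.
Local Open Scope quotient_scope.

(** * Shuffles of words *)

Section Shuffle.
Variable T : eqType.
Implicit Types u v w : seq T.

(** Equal words are kept as often as they arise, so that sums over this list count shuffles with
    multiplicity. The inner [fix] is there because either argument may shrink. *)
Fixpoint shuffle u := fix shuffle_u v : seq (seq T) :=
  match u, v with
  | a :: u', b :: v' =>
      map (cons a) (shuffle u' v) ++ map (cons b) (shuffle_u v')
  | [::], _ => [:: v]
  | _, [::] => [:: u]
  end.

Lemma shuffle0s v : shuffle [::] v = [:: v]. Proof. by case: v. Qed.
Lemma shuffles0 u : shuffle u [::] = [:: u]. Proof. by case: u. Qed.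

Lemma shuffle_cons a u b v : shuffle (a :: u) (b :: v) =
  map (cons a) (shuffle u (b :: v)) ++ map (cons b) (shuffle (a :: u) v).
Proof. by []. Qed.

Lemma shuffle_ind (P : seq T -> seq T -> Prop) :
  (forall v, P [::] v) -> (forall u, P u [::]) ->
  (forall a u b v, P u (b :: v) -> P (a :: u) v -> P (a :: u) (b :: v)) ->
  forall u v, P u v.
Proof.
move=> P0s Ps0 Pc; elim=> [|a u IHu] //; elim=> [|b v IHv] //.
exact: Pc.
Qed.

Lemma perm_shuffle u v w : w \in shuffle u v -> perm_eq w (u ++ v).
Proof.
move: u v w; apply: shuffle_ind => [v|u|a u b v IHu IHv] w.
- by rewrite shuffle0s inE => /eqP->.
- by rewrite shuffles0 inE cats0 => /eqP->.
rewrite shuffle_cons mem_cat => /orP[] /mapP[w' w'in ->].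
  by rewrite /= perm_cons IHu.
by rewrite -[b :: v]cat1s perm_sym perm_catCA /= perm_cons perm_sym IHv.
Qed.

Lemma size_shuffle u v : size (shuffle u v) = 'C(size u + size v, size u).
Proof.
move: u v; apply: shuffle_ind => [v|u|a u b v IHu IHv].
- by rewrite shuffle0s bin0.
- by rewrite shuffles0 addn0 binn.
rewrite shuffle_cons size_cat !size_map IHu IHv /=.
by rewrite addnC [in RHS]addSn binS addnS addSn.
Qed.

Lemma shuffle_uniq u v : uniq (u ++ v) -> uniq (shuffle u v).
Proof.
have cons_inj (a : T) : injective (cons a) by move=> ? ? [].
move: u v; apply: shuffle_ind => [v|u|a u b v IHu IHv].
- by rewrite shuffle0s.
- by rewrite shuffles0.
move=> uniq_uv; have : uniq ((a :: u) ++ v).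
  by apply: subseq_uniq uniq_uv; apply: cat_subseq => //; exact: subseq_cons.
move: uniq_uv; rewrite /= mem_cat inE !negb_or => /andP[/and3P[_ ab _]].
move=> /IHu uniq_u /IHv uniq_v; rewrite -/(shuffle _ _).
rewrite -/(shuffle (a :: u) v) cat_uniq !map_inj_uniq // uniq_u uniq_v andbT.
apply/hasPn => _ /mapP[w _ ->]; apply/mapP => -[w' _ [ba _]].
by rewrite ba eqxx in ab.
Qed.

(** Meant for words of distinct indices, where it turns the recursive shuffles into the order
    conditions defining [shuffle_perms]. *)
Lemma mem_shuffle u v w : uniq (u ++ v) ->
  (w \in shuffle u v) = [&& perm_eq w (u ++ v), subseq u w & subseq v w].
Proof.
move: u v w; apply: shuffle_ind => [v|u|a u b v IHu IHv] w uniq_uv.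
- rewrite shuffle0s inE sub0seq /=;
  apply/eqP/andP => [->//|[/perm_size sz sub]].
  by apply/esym/eqP; rewrite -(size_subseq_leqif sub).2 sz.
- rewrite shuffles0 inE cats0 sub0seq andbT;
  apply/eqP/andP => [->//|[/perm_size sz sub]].
  by apply/esym/eqP; rewrite -(size_subseq_leqif sub).2 sz.
have uniq_u : uniq (u ++ b :: v) by case/andP: uniq_uv.
have uniq_v : uniq ((a :: u) ++ v).
  apply: subseq_uniq uniq_uv; apply: cat_subseq => //; exact: subseq_cons.
have permb x : perm_eq (b :: x) ((a :: u) ++ b :: v) = perm_eq x ((a :: u) ++
  v).
  by rewrite -[b :: v]cat1s perm_sym perm_catCA /= perm_cons perm_sym.
have [ab anu anv bnu bnv] : [/\ a != b, a \notin u, a \notin v, b \notin u & b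
  \notin v].
  have : b \notin u ++ v.
    by move: uniq_u; rewrite -[b :: v]cat1s uniq_catCA /= => /andP[].
  move: uniq_uv => /= /andP[+ _]; rewrite !mem_cat inE !negb_or.
  by move=> /and3P[-> -> ->] /andP[-> ->].
rewrite shuffle_cons mem_cat; case: w => [|c w].
  by apply/orP/and3P => [[]/mapP[]//|[/perm_size]].
apply/orP/and3P => [[]/mapP[w' win [-> ->]]|[pw su sv]].
- move: win; rewrite IHu // => /and3P[pw su sv]; split.
  + by rewrite /= perm_cons.
  + by rewrite /= eqxx.
  + exact: subseq_trans sv (subseq_cons _ _).
- move: win; rewrite IHv // => /and3P[pw su sv]; split.
  + by rewrite permb.
  + exact: subseq_trans su (subseq_cons _ _).
  + by rewrite /= eqxx.
have cuv : c \in (a :: u) ++ b :: v by rewrite -(perm_mem pw) mem_head.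
have uw : uniq (c :: w) by rewrite (perm_uniq pw).
have [ca|ca] := eqVneq c a.
  subst c; left; apply: map_f; rewrite IHu //; apply/and3P; split.
  - by rewrite /= perm_cons in pw.
  - by rewrite /= eqxx in su.
  - by move: sv; rewrite /= (eq_sym b) (negPf ab).
have [cb|cb] := eqVneq c b.
  subst c; right; apply: map_f; rewrite IHv //; apply/and3P; split.
  - by rewrite -permb.
  - by move: su; rewrite /= (negPf ab).
  - by rewrite /= eqxx in sv.
(* A first letter other than [a] and [b] puts both words inside [w], so that [c] would occur twice
   in [c :: w]. *)
have su' : subseq (a :: u) w by move: su; rewrite /= eq_sym (negPf ca).
have sv' : subseq (b :: v) w by move: sv; rewrite /= eq_sym (negPf cb).
move: cuv uw; rewrite mem_cat /= => /orP[/(mem_subseq su')->//|].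
by move=> /(mem_subseq sv')->.
Qed.

End Shuffle.

Lemma map_shuffle (T T' : eqType) (f : T -> T') (u v : seq T) :
  map (map f) (shuffle u v) = shuffle (map f u) (map f v).
Proof.
move: u v; apply: shuffle_ind => [v|u|a u b v IHu IHv].
- by rewrite !shuffle0s.
- by rewrite !shuffles0.
rewrite shuffle_cons /= map_cat -!map_comp.
rewrite -/(shuffle (f a :: map f u) (map f v)).
rewrite -[map f (a :: u)]/(f a :: map f u) in IHv.
rewrite -[map f (b :: v)]/(f b :: map f v) in IHu.
by rewrite -IHu -IHv -!map_comp.
Qed.

Lemma sorted_map_enum (T : Type) (e : rel T) k (f : 'I_k -> T) :
  transitive e -> sorted e (map f (enum 'I_k)) =
  [forall i : 'I_k, forall j : 'I_k, (i < j)%N ==> e (f i) (f j)].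
Proof.
move=> trs; have szk : size (map f (enum 'I_k)) = k by rewrite size_map
  size_enum_ord.
have nthk x0 (i : 'I_k) : nth x0 (map f (enum 'I_k)) i = f i.
  by rewrite (nth_map i) ?size_enum_ord // nth_ord_enum.
apply/idP/idP => [st|/forallP ltP].
  apply/forallP => i; apply/forallP => j; apply/implyP => ij.
  have := sorted_ltn_nth trs (f i) st.
  by move/(_ i j); rewrite !inE szk /= !nthk; apply.
rewrite sorted_map; apply: (path.sub_sorted (e := relpre val ltn)) => [i j ij|].
  by have /forallP/(_ j)/implyP := ltP i; apply.
by rewrite -sorted_map val_enum_ord iota_ltn_sorted.
Qed.

(** * Shuffle permutations versus shuffles of words *)

Section ShufflePerms.
Variables N N' : nat.
Local Notation n := (N + N')%N.
Implicit Types s : 'S_n.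

Let left : seq 'I_n := map (lshift N') (enum 'I_N).
Let right : seq 'I_n := map (@rshift N N') (enum 'I_N').

Let enum_left_right : enum 'I_n = left ++ right.
Proof.
apply: (inj_map val_inj); rewrite val_enum_ord iotaD map_cat.
rewrite -(map_comp val (lshift N')) -(map_comp val (@rshift N N')).
congr (_ ++ _); first by rewrite -val_enum_ord; apply: eq_map.
rewrite add0n -[in LHS](addn0 N) iotaDl -val_enum_ord -map_comp.
by apply: eq_map.
Qed.

Let perm_word s : seq 'I_n := [seq (s^-1)%g i | i <- enum 'I_n].

Let perm_cat_word s : perm_eq (perm_word s) (left ++ right).
Proof.
rewrite -enum_left_right; apply: uniq_perm; rewrite ?enum_uniq //.
  by rewrite map_inj_uniq ?enum_uniq //; exact: perm_inj.
move=> i; rewrite mem_enum [RHS]inE; apply/mapP; exists (s i).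
  by rewrite mem_enum.
by rewrite permK.
Qed.

Let uniq_left_right : uniq (left ++ right).
Proof. by rewrite -enum_left_right enum_uniq. Qed.

Let before s : rel 'I_n := fun i j => (s i < s j)%N.

Let sorted_perm_word s : sorted (before s) (perm_word s).
Proof.
rewrite /perm_word sorted_map; apply: (path.sub_sorted (e := relpre val ltn)).
  by move=> i j; rewrite /before /= !permKV.
by rewrite -sorted_map val_enum_ord iota_ltn_sorted.
Qed.

(** [perm_word s] lists all indices by increasing image under [s]; a word sorted for this order is
    recovered by filtering that list. *)
Let subseq_perm_word s x : uniq x ->
  subseq x (perm_word s) = sorted (before s) x.
Proof.
have trs : transitive (before s) by move=> ? ? ?; exact: ltn_trans.
move=> ux; apply/idP/idP => [sx|sx];
  first exact: subseq_sorted (sorted_perm_word s).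
rewrite (_ : x = filter (mem x) (perm_word s)) ?filter_subseq //.
apply: (irr_sorted_eq trs) => //.
- by move=> i; exact: ltnn.
- exact: sorted_filter.
move=> i; rewrite mem_filter (perm_mem (perm_cat_word s)) -enum_left_right
  mem_enum.
by rewrite [i \in 'I_n]inE andbT.
Qed.

Let sorted_shift k (sh : 'I_k -> 'I_n) s :
  sorted (before s) (map sh (enum 'I_k)) =
  [forall i : 'I_k, forall j : 'I_k, (i < j)%N ==> (s (sh i) < s (sh j))%N].
Proof. by apply: sorted_map_enum => ? ? ?; exact: ltn_trans. Qed.

(** Letters of [u] and [v] may repeat, so the bijection is made on positions: [left] and [right]
    have distinct letters, [perm_word] is injective, and [mem_shuffle] identifies its image. Passing
    from positions to letters commutes with shuffling. *)
Lemma sum_shuffle_perms (T : eqType) (V : nmodType) (F : seq T -> V)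
    (u : N.-tuple T) (v : N'.-tuple T) :
  \sum_(s in shuffle_perms N N')
    F [seq tnth (cat_tuple u v) ((s^-1)%g i) | i <- enum 'I_n] =
  \sum_(w <- shuffle u v) F w.
Proof.
have -> : tval u = map (tnth (cat_tuple u v)) left.
  rewrite -(map_comp _ (lshift N')) -[LHS]map_tnth_enum; apply: eq_map => i /=.
  by rewrite tnth_lshift.
have -> : tval v = map (tnth (cat_tuple u v)) right.
  rewrite -(map_comp _ (@rshift N N')) -[LHS]map_tnth_enum;
    apply: eq_map => i /=.
  by rewrite tnth_rshift.
pose G w := F (map (tnth (cat_tuple u v)) w).
rewrite -map_shuffle big_map -/G (eq_bigr (G \o perm_word)) => [|s _];
  last first.
  by rewrite /G /perm_word /= -(map_comp _ (s^-1)%g).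
rewrite -big_enum -(big_map perm_word predT G) /=; apply: perm_big.
apply: uniq_perm.
- rewrite map_inj_uniq ?enum_uniq // => s s' /eq_in_map ss'.
  by apply/invg_inj/permP => i; apply: ss'; rewrite mem_enum.
- exact: shuffle_uniq.
have [uniq_left _ uniq_right] : [/\ uniq left, True & uniq right].
  by move: uniq_left_right; rewrite cat_uniq => /and3P[-> _ ->].
move=> w; rewrite mem_shuffle //; apply/mapP/and3P => [[s]|[pw lw rw]].
  rewrite mem_enum inE => /andP[sl sr] ->; split=> //.
    by rewrite subseq_perm_word // sorted_shift.
  by rewrite subseq_perm_word // sorted_shift.
have uw : uniq w by rewrite (perm_uniq pw).
have sw : size w = n by rewrite (perm_size pw) -enum_left_right size_enum_ord.
(* Reading off the letters of [w] gives the inverse of the permutation sought. The default [i] of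
   [nth] avoids choosing an element of ['I_n], which may be empty. *)
have nth_inj : injective (fun i : 'I_n => nth i w i).
  move=> i j; rewrite (set_nth_default i j) ?sw // => /eqP.
  by rewrite nth_uniq ?sw // => /eqP/val_inj.
have ws : w = perm_word (perm nth_inj)^-1.
  rewrite /perm_word invgK; case: n w sw nth_inj {pw lw rw uw} =>
    [|m] w sw nth_inj.
    by rewrite enum_ord0; exact: size0nil sw.
  apply: (eq_from_nth (x0 := ord0)) => [|i]; rewrite sw.
    by rewrite size_map -cardE card_ord.
  move=> im.
  rewrite (nth_map ord0) ?size_enum_ord // permE (nth_ord_enum ord0 (Ordinal
    im)).
  by apply: set_nth_default; rewrite sw.
exists (perm nth_inj)^-1%g => //; rewrite mem_enum inE -!sorted_shift.
by rewrite -!subseq_perm_word -?ws ?lw.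
Qed.
End ShufflePerms.

(** * Shuffle characters *)

Section Convolution.
Variables (T : eqType) (A : comNzRingType).
Implicit Types (f g h : seq T -> A) (u v w : seq T).

(** The product of noncommutative power series, [f w] being the coefficient of [w]. *)
Definition conv f g w : A :=
  \sum_(k < (size w).+1) f (take k w) * g (drop k w).

Definition conv_unit w : A := (nilp w)%:R.

Lemma conv_nil f g : conv f g [::] = f [::] * g [::].
Proof. by rewrite /conv big_ord1. Qed.

Lemma conv_cons f g a w :
  conv f g (a :: w) = f [::] * g (a :: w) + conv (f \o cons a) g w.
Proof. by rewrite /conv big_ord_recl. Qed.

Lemma conv1f f w : conv conv_unit f w = f w.
Proof.
rewrite /conv big_ord_recl /conv_unit take0 drop0 mul1r big1 ?addr0 // => k _.
by case: w k => [|a w] [k ltk] //=; rewrite mul0r.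
Qed.

Lemma convf1 f w : conv f conv_unit w = f w.
Proof.
elim: w f => [|a w IHw] f; first by rewrite conv_nil mulr1.
by rewrite conv_cons /conv_unit mulr0 add0r -/conv_unit IHw.
Qed.

Lemma convA f g h w : conv f (conv g h) w = conv (conv f g) h w.
Proof.
elim: w f g => [|a w IHw] f g; first by rewrite !conv_nil mulrA.
rewrite !conv_cons IHw mulrDr mulrA conv_nil -addrA; congr (_ + _).
rewrite /conv mulr_sumr -big_split /=; apply: eq_bigr => k _.
by rewrite mulrA -mulrDl -conv_cons.
Qed.

Definition shsum f u v : A := \sum_(w <- shuffle u v) f w.

Lemma shsum0s f v : shsum f [::] v = f v.
Proof. by rewrite /shsum shuffle0s big_seq1. Qed.

Lemma shsums0 f u : shsum f u [::] = f u.
Proof. by rewrite /shsum shuffles0 big_seq1. Qed.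

Lemma shsum_cons f a u b v : shsum f (a :: u) (b :: v) =
  shsum (f \o cons a) u (b :: v) + shsum (f \o cons b) (a :: u) v.
Proof. by rewrite /shsum shuffle_cons big_cat !big_map. Qed.

(* Deconcatenation is multiplicative for the shuffle product. *)
Lemma shsum_conv f g u v : shsum (conv f g) u v =
  \sum_(i < (size u).+1) \sum_(j < (size v).+1)
    shsum f (take i u) (take j v) * shsum g (drop i u) (drop j v).
Proof.
move: u v f; apply: shuffle_ind => [v|u|a u b v IHu IHv] f.
- rewrite shsum0s big_ord1; apply: eq_bigr => j _.
  by rewrite !shsum0s.
- rewrite shsums0; apply: eq_bigr => j _.
  by rewrite big_ord1 !shsums0.
have convE c w : (conv f g \o cons c) w = f [::] * g (c :: w) + conv (f \o cons
  c) g w.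
  exact: conv_cons.
rewrite shsum_cons {1 2}/shsum (eq_bigr _ (fun w _ => convE a w)).
rewrite (eq_bigr _ (fun w _ => convE b w)) !big_split /= -!mulr_sumr.
rewrite addrACA -mulrDr -/(shsum (conv (f \o cons a) g) u (b :: v)).
rewrite -/(shsum (conv (f \o cons b) g) (a :: u) v) IHu IHv.
rewrite -/(shsum (g \o cons a) u (b :: v)) -/(shsum (g \o cons b) (a :: u) v).
rewrite -shsum_cons [RHS]big_ord_recl /= [in RHS]big_ord_recl /=.
rewrite -!addrA shsum0s; congr (_ + _).
rewrite [in X in _ + X]big_ord_recl /= addrCA; congr (_ + _).
  by apply: eq_bigr => j _; rewrite !shsum0s.
rewrite -big_split; apply: eq_bigr => i _ /=.
rewrite big_ord_recl [in RHS]big_ord_recl /= !shsums0 -addrA; congr (_ + _).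
by rewrite -big_split; apply: eq_bigr => j _ /=; rewrite shsum_cons mulrDl.
Qed.

Definition shuffle_char f :=
  f [::] = 1 /\ forall u v, f u * f v = shsum f u v.

Lemma conv_unit_char : shuffle_char conv_unit.
Proof.
split=> //; apply: shuffle_ind => [v|u|a u b v _ _].
- by rewrite shsum0s mul1r.
- by rewrite shsums0 mulr1.
by rewrite mul0r shsum_cons /shsum !big1 ?addr0.
Qed.

(** By [shsum_conv] the sum over shuffles splits over pairs of prefixes of [u] and [v], to which
    both hypotheses apply. *)
Lemma conv_char f g :
  shuffle_char f -> shuffle_char g -> shuffle_char (conv f g).
Proof.
move=> [f1 fM] [g1 gM]; split=> [|u v]; first by rewrite conv_nil f1 g1 mulr1.
rewrite shsum_conv /conv mulr_suml; apply: eq_bigr => i _; rewrite mulr_sumr.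
by apply: eq_bigr => j _; rewrite -fM -gM mulrACA.
Qed.

End Convolution.

(** * Divided powers and the exponential of one letter *)

Section Exponential.
Variables (K : numFieldType) (A : comAlgType K).
Implicit Types (s t : A).

Definition dpow t n : A := (n`!%:R^-1 : K) *: t ^+ n.

Lemma dpow0 t : dpow t 0 = 1.
Proof. by rewrite /dpow expr0 invr1 scale1r. Qed.

Lemma dpow_0 n : dpow 0 n = (n == 0%N)%:R.
Proof. by rewrite /dpow expr0n; case: n => [|n];
  rewrite ?invr1 ?scale1r ?scaler0. Qed.

Lemma fact_neq0 n : n`!%:R != 0 :> K.
Proof. by rewrite pnatr_eq0 -lt0n fact_gt0. Qed.

Lemma dpowM t m n : dpow t m * dpow t n = dpow t (m + n) *+ 'C(m + n, m).
Proof.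
rewrite /dpow -scalerAl -scalerAr scalerA -exprD -scaler_nat scalerA.
congr (_ *: _); rewrite -(bin_fact (leq_addr n m)) addKn !natrM.
have := fact_neq0 m; have := fact_neq0 n.
have : 'C(m + n, m)%:R != 0 :> K by rewrite pnatr_eq0 -lt0n bin_gt0 leq_addr.
by move=> ? ? ?; field; apply/and3P.
Qed.

Lemma dpowD s t n : dpow (s + t) n = \sum_(k < n.+1) dpow s k * dpow t (n - k).
Proof.
rewrite /dpow addrC exprDn scaler_sumr; apply: eq_bigr => k _.
have kn : (k <= n)%N by rewrite -ltnS.
rewrite -scalerAl -scalerAr scalerA mulrC -scaler_nat scalerA; congr (_ *: _).
rewrite -(bin_fact kn) !natrM.
have := fact_neq0 k; have := fact_neq0 (n - k).
have : 'C(n, k)%:R != 0 :> K by rewrite pnatr_eq0 -lt0n bin_gt0.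
by move=> ? ? ?; field; apply/and3P.
Qed.

Variable T : eqType.
Implicit Types (b : T) (u v w : seq T).

(* The series exp (t b). *)
Definition expw b t w : A := if all (pred1 b) w then dpow t (size w) else 0.

(** All shuffles of [u] and [v] have the same letters and length, so the sum is one value times
    their number, the binomial coefficient of [dpowM]. *)
Lemma expw_char b t : shuffle_char (expw b t).
Proof.
split=> [|u v]; first by rewrite /expw dpow0.
rewrite /shsum big_seq (eq_bigr (fun=> if all (pred1 b) (u ++ v)
  then dpow t (size u + size v) else 0)) => [|w /perm_shuffle pw]; last first.
  by rewrite /expw (perm_all _ pw) (perm_size pw) size_cat.
rewrite -big_seq big_const_seq count_predT size_shuffle iter_addr_0 /expw.
rewrite all_cat; case: (all _ u); case: (all _ v) => /=;
  by rewrite ?dpowM // ?(mul0r, mulr0) mul0rn.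
Qed.

Lemma conv_expwD b s t w : conv (expw b s) (expw b t) w = expw b (s + t) w.
Proof.
have [wb|nb] := boolP (all (pred1 b) w); last first.
  rewrite /conv /expw (negPf nb) big1 // => k _.
  move: nb; rewrite -{1}(cat_take_drop k w) all_cat negb_and.
  by case/orP=> /negPf->; rewrite ?mul0r ?mulr0.
rewrite /expw wb dpowD; apply: eq_bigr => k _.
move: wb; rewrite -{1}(cat_take_drop k w) all_cat => /andP[-> ->].
by rewrite size_drop size_takel // -ltnS.
Qed.

Lemma expw0 b w : expw b 0 w = conv_unit A w.
Proof.
rewrite /expw /conv_unit dpow_0.
by case: w => [|a w] //=; case: ifP.
Qed.

End Exponential.

(** * Homomorphisms on formal iterated integrals *)

Section QuotientLift.
Variables (B A : comNzRingType) (J : idealr B) (phi : {rmorphism B -> A}).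
Hypothesis phiJ : forall x, x \in J -> phi x = 0.
Local Notation Q := (@Quotient.quot B J).

Let lift (x : Q) : A := phi (repr x).

Let lift_pi x : lift (\pi_Q x) = phi x.
Proof.
apply/eqP; rewrite -subr_eq0 -rmorphB; apply/eqP/phiJ.
by rewrite Quotient.idealrBE reprK.
Qed.

Let lift_additive : {morph lift : x y / x - y}.
Proof.
move=> x y; rewrite -[x]reprK -[y]reprK -rmorphB /= !lift_pi.
exact: rmorphB.
Qed.

Let lift_multiplicative : monoid_morphism lift.
Proof.
split=> [|x y]; first by rewrite -(rmorph1 \pi_Q) lift_pi rmorph1.
rewrite -[x]reprK -[y]reprK -rmorphM /= !lift_pi.
exact: rmorphM.
Qed.

Definition quotient_lift : {rmorphism Q -> A} :=
  HB.pack lift (GRing.isZmodMorphism.Build Q A lift lift_additive)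
    (GRing.isMonoidMorphism.Build Q A lift lift_multiplicative).

Lemma quotient_liftE x : quotient_lift (\pi_Q x) = phi x.
Proof. exact: lift_pi. Qed.

End QuotientLift.

Section FreeLift.
Variables (A : comNzRingType) (f : {rmorphism rat -> A}) (val : isym -> A).

Definition monom_lift (m : cmonom isym) : A :=
  \prod_(i <- enum_fset (finsupp m)) val i ^+ m i.

Fact monom_lift_morph : mmorphism monom_lift.
Proof.
have incl (m : cmonom isym) d : fsubset (finsupp m) d ->
    monom_lift m = \prod_(i <- enum_fset d) val i ^+ m i.
  move=> sd; rewrite /monom_lift; apply: big_fset_incl => // i _.
  by rewrite -cmE_eq0 => /eqP->.
split=> [x y|]; last by rewrite /monom_lift mdom1 big_seq_fset0.
have sub := fsubset_refl (finsupp (mmul x y)).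
move: (sub); rewrite {1}mdomD fsubUset => /andP[sx sy].
rewrite (incl _ _ sx) (incl _ _ sy) /monom_lift -big_split /=.
by apply: eq_bigr => i _; rewrite cmM exprD.
Qed.

HB.instance Definition _ :=
  isMultiplicative.Build (cmonom isym) A monom_lift monom_lift_morph.

Definition free_lift : {rmorphism Ifree -> A} := mmap f monom_lift.

Lemma free_lift_Isym a w b : free_lift (Isym a w b) = val (a, w, b).
Proof.
rewrite Isym.unlock /free_lift /= mmapU [X in X * _](rmorph1 f) mul1r
  /monom_lift mdomU.
by rewrite big_seq_fset1 cmUU.
Qed.

Lemma free_liftZ c x : free_lift (c *: x) = f c * free_lift x.
Proof. exact: mmapZ. Qed.

End FreeLift.

Section IteratedIntegrals.
Variables (A : comNzRingType) (f : {rmorphism rat -> A}).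
Variables chi chi' : seq bool -> A.
Hypotheses (chi_char : shuffle_char chi) (chi'_char : shuffle_char chi').
Hypotheses (conv_chi : forall w, conv chi chi' w = conv_unit A w).
Hypotheses (conv_chi' : forall w, conv chi' chi w = conv_unit A w).
Hypothesis chi_false : chi [:: false] = 0.

Definition path_char (a b : bool) : seq bool -> A :=
  if a == b then @conv_unit _ A else if b then chi else chi'.

Lemma path_charP a b : shuffle_char (path_char a b).
Proof.
by rewrite /path_char; case: a b => -[] //=; exact: conv_unit_char.
Qed.

(** Every case is a unit law or one of the two hypotheses that [chi] and [chi'] are inverse to each
    other. *)
Lemma path_char_conv a x b w :
  conv (path_char a x) (path_char x b) w = path_char a b w.
Proof. by rewrite /path_char; case: a x b => -[] [] //=;
  rewrite ?conv1f ?convf1. Qed.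

Let phi := free_lift f (fun i : isym => path_char i.1.1 i.2 i.1.2).

Let phiE a w b : phi (Isym a w b) = path_char a b w.
Proof. exact: free_lift_Isym. Qed.

(** (I1) and (I2) hold because each [path_char a b] is a shuffle character, (I3) is
    [path_char_conv], and (I4) holds because loops go to [conv_unit]. *)
Let phi_Irel x : Irel x -> phi x = 0.
Proof.
case=> [a b|N N' a b u v|a b y w|a w wn].
- by rewrite rmorphB rmorph1 phiE (path_charP a b).1 subrr.
- apply/eqP; rewrite rmorphB rmorphM rmorph_sum !phiE subr_eq0; apply/eqP.
  rewrite (path_charP a b).2 /shsum -sum_shuffle_perms.
  by apply: eq_bigr => s _; rewrite phiE.
- apply/eqP; rewrite rmorphB rmorph_sum phiE subr_eq0 -(path_char_conv a y b).
  by apply/eqP/eq_bigr => k _; rewrite rmorphM !phiE.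
- by rewrite phiE /path_char eqxx /conv_unit; case: w wn.
Qed.

Let phi_Iideal x : x \in Iideal -> phi x = 0.
Proof.
move=> /asboolP[t tI ->]; rewrite rmorph_sum big1_seq // => p /andP[_ pt].
by rewrite rmorphM [X in _ * X]phi_Irel ?mulr0 //; exact: tI.
Qed.

Let psi : {rmorphism Ialg -> A} := quotient_lift phi_Iideal.

Let psi_II a w b : psi (II a w b) = path_char a b w.
Proof. by rewrite -phiE; exact: (quotient_liftE phi_Iideal). Qed.

Let psi_Iideal0 x : x \in Iideal0 -> psi x = 0.
Proof. by move=> /asboolP[y ->];
  rewrite rmorphM [X in X * _]psi_II [X in X * _]chi_false mul0r. Qed.

Let g0 : {rmorphism I1alg -> A} := quotient_lift psi_Iideal0.

(** Rational scalars act on [A] through [f], because the target used later is an algebra over the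
    complex numbers. *)
Lemma I1alg_lift : exists g : {rmorphism I1alg -> A},
  (forall w, g (I1 false w true) = chi w)
  /\ forall c x, g (c *: x) = f c * g x.
Proof.
exists g0; split=> [w|c x].
  transitivity (psi (II false w true)); last exact: psi_II.
  exact: (quotient_liftE psi_Iideal0).
(* Scaling by [c] on a quotient is multiplication by the class of [c%:A], so it suffices to know
   [g0] there. *)
have g0Z : g0 (\pi_(@Quotient.quot Ialg Iideal0) c%:A) = f c.
  transitivity (psi c%:A); first exact: (quotient_liftE psi_Iideal0).
  have -> : c%:A = \pi_(@Quotient.quot Ifree Iideal) c%:A :> Ialg.
    by rewrite /GRing.scale /= /qscale mulr1.
  transitivity (phi c%:A); first exact: (quotient_liftE phi_Iideal).
  by rewrite free_liftZ rmorph1 mulr1.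
by rewrite -g0Z -rmorphM.
Qed.

End IteratedIntegrals.

(** * The elements I(n_1, ..., n_r) span *)

Definition quotient_pi (B : comNzRingType) (J : idealr B) :
  {rmorphism B -> @Quotient.quot B J} := \pi_(@Quotient.quot B J).

Lemma quotient_piZ (K : comNzRingType) (B : comAlgType K) (J : idealr B) c x :
  quotient_pi J (c *: x) = c *: quotient_pi J x.
Proof. by rewrite -[c *: x]mulr_algl rmorphM. Qed.

Definition pi_I : {rmorphism Ifree -> Ialg} := quotient_pi Iideal.
Definition pi_I1 : {rmorphism Ialg -> I1alg} := quotient_pi Iideal0.
Definition to_I1 : {rmorphism Ifree -> I1alg} := pi_I1 \o pi_I.

Lemma quotient_pi_eq0 (B : comNzRingType) (J : idealr B) x :
  x \in J -> quotient_pi J x = 0.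
Proof.
move=> xJ; rewrite -[RHS](rmorph0 (quotient_pi J)).
by apply/eqP; rewrite -Quotient.idealrBE subr0.
Qed.


Lemma to_I1Z c x : to_I1 (c *: x) = c *: to_I1 x.
Proof.
transitivity (pi_I1 (c *: pi_I x)).
  by congr (pi_I1 _); exact: (@quotient_piZ _ Ifree Iideal).
transitivity (pi_I1 (c%:A * pi_I x)).
  by rewrite mulr_algl.
exact: (rmorphM pi_I1).
Qed.

Lemma pi_I_surj x : exists y, x = pi_I y.
Proof. by exists (repr (x : @Quotient.quot Ifree Iideal)); symmetry;
  exact: reprK. Qed.

Lemma pi_I1_reprK x : exists y, x = \pi_(@Quotient.quot Ialg Iideal0) y.
Proof. exists (repr (x : @Quotient.quot Ialg Iideal0)); symmetry;
  exact: reprK. Qed.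

Lemma pi_I1_surj x : exists y, x = pi_I1 y.
Proof. have [y ->] := pi_I1_reprK x; exists y; reflexivity. Qed.

Lemma to_I1_surj x : exists y, x = to_I1 y.
Proof. by have [y ->] := pi_I1_surj x; have [z ->] := pi_I_surj y;
  exists z. Qed.

Lemma to_I1_Irel x : Irel x -> to_I1 x = 0.
Proof.
move=> xI; transitivity (pi_I1 0); last exact: rmorph0.
congr (pi_I1 _); apply: (quotient_pi_eq0 (J := Iideal)).
apply/asboolP; exists [:: (1, x)]; last by rewrite big_seq1 mul1r.
by move=> p; rewrite inE => /eqP->.
Qed.

Lemma I1_false : I1 false [:: false] true = 0.
Proof.
apply: (quotient_pi_eq0 (J := Iideal0)); apply/asboolP.
by exists 1; rewrite mulr1.
Qed.

(** Opaque, so that [projI1] is known only through these four properties and does not unfold to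
    nested quotients. *)
Lemma I1alg_quotient : {p : {rmorphism Ifree -> I1alg} |
  [/\ forall a w b, p (Isym a w b) = I1 a w b,
      forall x, Irel x -> p x = 0,
      forall c x, p (c *: x) = c *: p x
    & forall x, exists y, x = p y]}.
Proof.
exists to_I1; split=> [//|x|c x|x].
- exact: to_I1_Irel.
- exact: to_I1Z.
- exact: to_I1_surj.
Qed.

Definition projI1 : {rmorphism Ifree -> I1alg} := sval I1alg_quotient.

Lemma projI1_Isym a w b : projI1 (Isym a w b) = I1 a w b.
Proof. by have [pI _ _ _] := svalP I1alg_quotient; exact: pI. Qed.

Lemma projI1_eq x y : Irel (x - y) -> projI1 x = projI1 y.
Proof.
have [_ pI _ _] := svalP I1alg_quotient => /pI.
by rewrite rmorphB => /eqP; rewrite subr_eq0 => /eqP.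
Qed.

Lemma I1_nil a b : I1 a [::] b = 1.
Proof. by rewrite -projI1_Isym (projI1_eq (Irel1 a b)) rmorph1. Qed.

Lemma I1_shuffle a b u v : I1 a u b * I1 a v b = shsum (fun w => I1 a w b) u v.
Proof.
have := projI1_eq (Irel2 a b (in_tuple u) (in_tuple v)).
rewrite rmorphM rmorph_sum !projI1_Isym => ->.
rewrite /shsum -(sum_shuffle_perms (fun w => I1 a w b) (in_tuple u) (in_tuple
  v)).
by apply: eq_bigr => s _; rewrite projI1_Isym.
Qed.

Lemma I1_path a x b w : I1 a w b = conv (fun w => I1 a w x) (fun w => I1 x w b)
  w.
Proof.
rewrite -projI1_Isym (projI1_eq (Irel3 a b x w)) rmorph_sum.
by apply: eq_bigr => k _; rewrite rmorphM !projI1_Isym.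
Qed.

Lemma I1_loop a w : w != [::] -> I1 a w a = 0.
Proof.
move=> wn; rewrite -projI1_Isym -(rmorph0 projI1); apply: projI1_eq.
by rewrite subr0; constructor.
Qed.

Lemma mkmalgUZ (M : monomType) (S : comNzRingType) (m : M) (c : S) :
  mkmalgU m c = c *: mkmalgU m 1 :> malg M S.
Proof. by apply/malgP => k; rewrite mcoeffZ !mcoeffU mulrnAr mulr1. Qed.

(** Every element is the image of a polynomial in the symbols; monomials lose one symbol at a time,
    by induction on the degree. *)
Lemma I1alg_ind (P : I1alg -> Prop) :
  P 1 -> (forall x y, P x -> P y -> P (x + y)) ->
  (forall x y, P x -> P y -> P (x * y)) -> (forall c x, P x -> P (c *: x)) ->
  (forall a w b, P (I1 a w b)) -> forall x, P x.
Proof.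
move=> P1 PD PM PZ PI x; have [_ _ pZ /(_ x)[y ->]] := svalP I1alg_quotient.
have P0 : P 0 by rewrite -(scale0r 1); exact: PZ.
have PpM u v : P (projI1 u) -> P (projI1 v) -> P (projI1 (u * v)).
  by rewrite rmorphM; exact: PM.
have PpI a w b : P (projI1 (Isym a w b)) by rewrite projI1_Isym.
have IsymE a w b : Isym a w b = mkmalgU (ucm ((a, w, b) : isym)) 1.
  by rewrite Isym.unlock.
have Pmon (m : cmonom isym) : P (projI1 (mkmalgU m 1)).
  have [d] := ubnP (mdeg m); elim: d m => // d IHd m; rewrite ltnS => md.
  have [s|[i im]] := fset_0Vmem (finsupp m).
    have -> : m = mone.
      by apply/eqP/cmP => i; apply/eqP; rewrite cm1 cmE_eq0 s in_fset0.
    by move: P1; rewrite -(rmorph1 projI1).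
  have mE : m = mmul (ucm i) (divcm m (ucm i)).
    apply/eqP/cmP => j; rewrite cmM divcmE cmU.
    have [<-|//] := eqVneq i j; last by rewrite add0n subn0.
    by rewrite subnKC // lt0n cmE_neq0.
  have : (mdeg (divcm m (ucm i)) < d)%N.
    by apply: leq_trans md; rewrite [in X in (_ < X)%N]mE mdegM mdegU.
  have -> : mkmalgU m 1 = mkmalgU (ucm i) 1 * mkmalgU (divcm m (ucm i)) 1 :>
    Ifree.
    by rewrite malgM_def fgmulUU mulr1 -mE.
  move=> /IHd Pd; apply: PpM; last exact: Pd.
  case: i {im mE Pd} => -[a w] b; rewrite -IsymE; exact: PpI.
rewrite [y]monalgE rmorph_sum.
elim/big_ind: _ => // m _.
rewrite mkmalgUZ.
by rewrite [projI1 _]pZ; apply: PZ.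
Qed.

Definition idx_span (x : I1alg) : Prop :=
  exists s : seq (rat * seq nat),
    all (fun p => all (fun n => 0 < n)%N p.2) s /\ x = \sum_(p <- s) p.1 *:
      Iidx p.2.

Lemma idx_span0 : idx_span 0.
Proof. by exists [::]; rewrite big_nil. Qed.

Lemma idx_spanD x y : idx_span x -> idx_span y -> idx_span (x + y).
Proof.
move=> [s [sp ->]] [t [tp ->]]; exists (s ++ t).
by rewrite all_cat sp tp big_cat.
Qed.

Lemma idx_spanZ c x : idx_span x -> idx_span (c *: x).
Proof.
move=> [s [sp ->]]; exists [seq (c * p.1, p.2) | p <- s].
rewrite all_map big_map scaler_sumr; split=> //.
by apply: eq_bigr => p _; rewrite scalerA.
Qed.

Lemma idx_span_sum (I : Type) (r : seq I) (F : I -> I1alg) :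
  (forall i, idx_span (F i)) -> idx_span (\sum_(i <- r) F i).
Proof. by move=> sF; elim/big_ind: _ => //;
  [exact: idx_span0|exact: idx_spanD]. Qed.

Definition idx_word (ns : seq nat) : seq bool :=
  flatten [seq true :: nseq n.-1 false | n <- ns].

(** A letter 1 put in front absorbs the [k] leading zeros into a new entry [k.+1]. *)
Lemma idx_wordP w : exists k ns,
  all (fun n => 0 < n)%N ns /\ w = nseq k false ++ idx_word ns.
Proof.
elim: w => [|[] w [k [ns [nsp ->]]]]; first by exists 0%N, [::].
  by exists 0%N, (k.+1 :: ns).
by exists k.+1, ns.
Qed.

(** The [k.+1] insertions before [b] all give the same word; the others happen after [b]. *)
Lemma shsum_insert (A : comNzRingType) (F : seq bool -> A) k a b w : a != b ->
  shsum F [:: a] (nseq k a ++ b :: w) =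
  F (nseq k.+1 a ++ b :: w) *+ k.+1 + \sum_(x <- shuffle [:: a] w) F (nseq k a
    ++ b :: x).
Proof.
move=> ab; elim: k F => [|k IHk] F.
  by rewrite shsum_cons shsum0s.
by rewrite shsum_cons shsum0s IHk addrA -mulrS.
Qed.

Lemma shsum_nseq (A : comNzRingType) (F : seq bool -> A) k a :
  shsum F [:: a] (nseq k a) = F (nseq k.+1 a) *+ k.+1.
Proof.
elim: k F => [|k IHk] F; first by rewrite shsums0.
by rewrite shsum_cons shsum0s IHk -mulrS.
Qed.

Lemma scale_natK (n : nat) (x : I1alg) : n.+1%:R^-1 *: (x *+ n.+1) = x :> I1alg.
Proof. by rewrite -scaler_nat scalerA mulVf ?scale1r // pnatr_eq0. Qed.

(* Shuffling with I(0; 0; 1) = 0 moves a leading 0 past the first 1. *)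
Lemma idx_span_I1 w : idx_span (I1 false w true).
Proof.
have [k [ns [nsp ->]]] := idx_wordP w.
case: ns nsp => [_|n ns nsp].
  rewrite cats0; case: k => [|k].
    by exists [:: (1, [::])]; rewrite big_seq1 scale1r.
  (* A word of zeros only is, up to a factor, the product of I(0; 0; 1) and a shorter one, hence
     0. *)
  rewrite -(scale_natK k (I1 _ _ _)) -(shsum_nseq (fun w => I1 false w true)).
  by rewrite -I1_shuffle I1_false mul0r scaler0; exact: idx_span0.
elim: k n ns nsp => [|k IHk] n ns nsp.
  by exists [:: (1, n :: ns)]; rewrite all_seq1 big_seq1 scale1r.
rewrite -[idx_word _]/(true :: (nseq n.-1 false ++ idx_word ns)).
set v := nseq n.-1 false ++ _.
have := shsum_insert (fun w => I1 false w true) k v (isT : false != true).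
rewrite -I1_shuffle I1_false mul0r => /esym/eqP; rewrite addr_eq0 => /eqP vE.
rewrite -(scale_natK k (I1 _ _ _)) vE -scaleN1r; do 2!apply: idx_spanZ.
(* The 1 in front of [x] and the [k'] zeros that start [x] form an entry [k'.+1], so only [k]
   leading zeros remain. *)
apply: idx_span_sum => x; have [k' [ms [msp xE]]] := idx_wordP x.
by rewrite xE; exact: (IHk k'.+1 ms).
Qed.

Lemma idx_spanM x y : idx_span x -> idx_span y -> idx_span (x * y).
Proof.
move=> [s [_ ->]] [t [_ ->]]; rewrite mulr_suml; apply: idx_span_sum => p.
rewrite mulr_sumr; apply: idx_span_sum => q.
rewrite -scalerAl -scalerAr; do 2!apply: idx_spanZ; rewrite I1_shuffle.
by apply: idx_span_sum => w; exact: idx_span_I1.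
Qed.

Lemma idx_spanP x : idx_span x.
Proof.
have span1 : idx_span 1 by rewrite -(I1_nil false true); exact: idx_span_I1.
have span_loop a w : idx_span (I1 a w a).
  have [->|wn] := eqVneq w [::]; first by rewrite I1_nil.
  by rewrite I1_loop //; exact: idx_span0.
apply: I1alg_ind x => //; [exact: idx_spanD|exact: idx_spanM|exact: idx_spanZ|].
move=> a w b; have [<-//|] := eqVneq a b.
case: a b => -[] // _; last exact: idx_span_I1.
have [n] := ubnP (size w); elim: n w => // n IHn w; rewrite ltnS => wn.
(* Path composition from 0 through 1 back to 0: the empty prefix gives I(1; w; 0), and every other
   term has a shorter word on the path from 1 to 0. *)
have -> : I1 true w false = I1 false w false -
    \sum_(k < size w) I1 false (take k.+1 w) true * I1 true (drop k.+1 w) false.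
  rewrite [I1 false w false](I1_path false true) /conv big_ord_recl take0 drop0.
  by rewrite I1_nil mul1r addrK.
apply: idx_spanD => //; rewrite -scaleN1r; apply/idx_spanZ/idx_span_sum => k.
apply: idx_spanM; first exact: idx_span_I1.
apply: IHn; rewrite size_drop; apply: leq_trans wn.
by rewrite subnSK // leq_subr.
Qed.

(** * Coefficients of ordered products of exponentials *)

(** Entries count zeros, so I(n_1, ..., n_r) has entries n_j - 1. The leading zeros [a0] occur in
    the inductions below. *)
Definition block_word (a0 : nat) (a : seq nat) : seq bool :=
  nseq a0 false ++ flatten [seq true :: nseq n false | n <- a].

Lemma block_word_cons a0 n a :
  block_word a0 (n :: a) = nseq a0 false ++ true :: block_word n a.
Proof. by []. Qed.

(* The multisets of cardinality r with elements in {1, ..., M}, as decreasing *)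
(* lists of pairs (element, positive multiplicity).                           *)
Fixpoint multisets (M r : nat) : seq (seq (nat * nat)) :=
  if M is M'.+1 then
    multisets M' r ++
    flatten [seq map (cons (M, i.+1)) (multisets M' (r - i.+1)) | i <- iota 0 r]
  else if r is 0 then [:: [::]] else [::].

Definition expand (s : seq (nat * nat)) : seq nat :=
  flatten [seq nseq p.2 p.1 | p <- s].

Lemma sum_multisetsS (V : nmodType) (F : seq (nat * nat) -> V) M r :
  \sum_(s <- multisets M.+1 r) F s = \sum_(s <- multisets M r) F s +
    \sum_(i < r) \sum_(s <- multisets M (r - i.+1)) F ((M.+1, i.+1) :: s).
Proof.
rewrite big_cat /= big_flatten big_map; congr (_ + _).
rewrite -[X in iota 0 X]subn0 -/(index_iota 0 r) big_mkord.
by apply: eq_bigr => i _; rewrite big_map.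
Qed.

Section WordCoefficients.
Variables (K : numFieldType) (A : comAlgType K) (t : nat -> A) (c : A).

(** The product of exp (t_u e_1) e^(c e_0) for u = M, ..., 1: the telescoped W_M without its first
    factor e^(- c M e_0). *)
Fixpoint ordered_exp (M : nat) : seq bool -> A :=
  if M is M'.+1 then
    conv (expw true (t M)) (conv (expw false c) (ordered_exp M'))
  else @conv_unit _ A.

Definition multiset_weight (s : seq (nat * nat)) : A := \prod_(p <- s) dpow (t
  p.1) p.2.

(** Between letters 1 taken from the factors [p] and [w1] of [ordered_exp] there are [p - w1]
    factors e^(c e_0), and after a last one from [p] there are [p]; the zeros of that gap come from
    them. *)
Fixpoint gap_coef (p a0 : nat) (a w : seq nat) : A :=
  match a, w with
  | a1 :: a', w1 :: w' => dpow ((p%:R - w1%:R) * c) a0 * gap_coef w1 a1 a' w'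
  | _, _ => dpow (p%:R * c) a0
  end.

(** One more e^(c e_0) in front widens the first gap by one, by the binomial formula [dpowD]. *)
Lemma gap_coefS p a0 a w :
  \sum_(k < a0.+1) dpow c k * gap_coef p (a0 - k) a w = gap_coef p.+1 a0 a w.
Proof.
have pS q : (p.+1%:R - q) * c = c + (p%:R - q) * c by rewrite -natr1; ring.
have pS0 : p.+1%:R * c = c + p%:R * c by rewrite -natr1; ring.
case: a w => [|a1 a] [|w1 w] /=; rewrite ?pS0 ?dpowD // pS dpowD mulr_suml.
by apply: eq_bigr => k _; rewrite mulrA.
Qed.

Lemma gap_coef_id p a0 a1 a w :
  gap_coef p a0 (a1 :: a) (p :: w) = (a0 == 0%N)%:R * gap_coef p a1 a w.
Proof. by rewrite /= subrr mul0r dpow_0. Qed.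

(** Only prefixes inside the initial run of [b] contribute, since [w] does not start with [b]. *)
Lemma conv_expw_nseq (T : eqType) (b : T) (s : A) f n w :
  (if w is a :: _ then a != b else true) ->
  conv (expw b s) f (nseq n b ++ w) =
  \sum_(k < n.+1) dpow s k * f (nseq (n - k) b ++ w).
Proof.
move=> wb; rewrite /conv size_cat size_nseq.
rewrite -(big_mkord predT (fun k => expw b s (take k _) * f (drop k (nseq n b
  ++ w)))).
rewrite (big_cat_nat (n := n.+1)) ?ltnS ?leq_addr //= big_mkord.
rewrite [X in _ + X]big_nat_cond [X in _ + X]big1 ?addr0 => [|k /andP[/andP[nk
  kw] _]].
  apply: eq_bigr => k _; have kn : (k <= n)%N by rewrite -ltnS.
  rewrite takel_cat ?size_nseq // drop_cat size_nseq.
  rewrite take_nseq // drop_nseq /expw all_nseq /= eqxx orbT size_nseq.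
  have [//|nk] := ltnP k n.
  by rewrite (_ : k = n :> nat) ?subnn ?drop0 //; apply/eqP; rewrite eqn_leq kn.
rewrite take_cat size_nseq ltnNge (ltnW nk) /= /expw all_cat.
case: w wb kw => [|a w] /= ab kw; first by rewrite addn0 ltnS leqNgt nk in kw.
by rewrite -[(k - n)%N]prednK ?subn_gt0 //= (negPf ab) andbF mul0r.
Qed.

(** Generalizes [expw true] to arbitrary coefficients, a class closed under the shift of [e] caused
    by removing a leading 1. *)
Definition run_coef (e : nat -> A) (w : seq bool) : A :=
  if all (pred1 true) w then e (size w) else 0.

Lemma conv_run_cons e f w :
  conv (run_coef e) f (true :: w) = e 0 * f (true :: w) + conv (run_coef (e \o
    S)) f w.
Proof. by rewrite conv_cons. Qed.

Lemma conv_run_false e f w : (if w is a :: _ then ~~ a else true) ->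
  conv (run_coef e) f w = e 0 * f w.
Proof.
case: w => [_|[] // w _]; first by rewrite conv_nil.
by rewrite conv_cons [X in _ + X]big1 ?addr0 // => k _; rewrite /run_coef mul0r.
Qed.

(** Term [i] takes i + 1 letters 1 from the run, which forbids zeros before and between them. Equal
    consecutive entries [M.+1] encode this: their gap is 0, and [dpow 0 n] vanishes unless n = 0. *)
Lemma conv_run_block M e f :
  (forall a0 a, f (block_word a0 a) = \sum_(s <- multisets M (size a))
      multiset_weight s * gap_coef M.+1 a0 a (expand s)) ->
  forall a0 a, conv (run_coef e) f (block_word a0 a) =
    e 0 * f (block_word a0 a) +
    \sum_(i < size a) e i.+1 * \sum_(s <- multisets M (size a - i.+1))
      multiset_weight s * gap_coef M.+1 a0 a (nseq i.+1 M.+1 ++ expand s).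
Proof.
move=> fE a0 a; elim: a a0 e => [|a1 a IHa] a0 e.
  rewrite big_ord0 addr0 conv_run_false //.
  by rewrite /block_word cats0; case: a0.
have gapE (i : nat) s : gap_coef M.+1 a0 (a1 :: a) (nseq i.+1 M.+1 ++ s) =
    (a0 == 0%N)%:R * gap_coef M.+1 a1 a (nseq i M.+1 ++ s).
  by rewrite [nseq _ _ ++ _]/= gap_coef_id.
have [->|a0n] := eqVneq a0 0%N; last first.
  rewrite conv_run_false; last by case: (a0) a0n.
  rewrite big1 ?addr0 // => i _; rewrite big1 ?mulr0 // => s _.
  by rewrite gapE (negPf a0n) mul0r mulr0.
rewrite block_word_cons conv_run_cons IHa; congr (_ + _).
rewrite [size (a1 :: a)]/= big_ord_recl fE /=; congr (_ + _).
  congr (_ * _); rewrite subSS subn0; apply: eq_bigr => s _; congr (_ * _).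
  by rewrite subrr mul0r dpow_0 mul1r.
apply: eq_bigr => i _; rewrite subSS; congr (_ * _); apply: eq_bigr => s _.
by rewrite /= subrr mul0r dpow_0 mul1r.
Qed.

(** By induction on [M]: e^(c e_0) acts through [gap_coefS] and exp (t e_1) through
    [conv_run_block], where the number of letters taken is the multiplicity of [M.+1] in
    [sum_multisetsS]. *)
Lemma ordered_exp_block M a0 a : ordered_exp M (block_word a0 a) =
  \sum_(s <- multisets M (size a)) multiset_weight s * gap_coef M a0 a (expand
    s).
Proof.
elim: M a0 a => [|M IHM] a0 a.
  case: a => [|a1 a] /=; rewrite ?big_nil /block_word ?cats0.
    rewrite big_seq1 /multiset_weight big_nil !mul1r mul0r dpow_0.
    by rewrite /conv_unit; case: a0.
  by rewrite /conv_unit; case: a0.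
pose f := conv (expw false c) (ordered_exp M).
have fE b0 b : f (block_word b0 b) = \sum_(s <- multisets M (size b))
    multiset_weight s * gap_coef M.+1 b0 b (expand s).
  rewrite /f conv_expw_nseq; last by case: b.
  under eq_bigr => k _ do rewrite -/(block_word (b0 - k) b) IHM mulr_sumr.
  rewrite exchange_big; apply: eq_bigr => s _.
  by rewrite -gap_coefS mulr_sumr; apply: eq_bigr => k _; rewrite mulrCA.
rewrite [LHS](conv_run_block (dpow (t M.+1)) fE) sum_multisetsS.
rewrite dpow0 mul1r fE; congr (_ + _); apply: eq_bigr => i _.
rewrite mulr_sumr; apply: eq_bigr => s _.
by rewrite mulrA /multiset_weight big_cons.
Qed.

End WordCoefficients.

(** * Substitution of linear forms in exponential series *)

(* Imported only here because it shadows monalg. *)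
From mathcomp Require Import mpoly.

Section Multinomial.
Variables (K : numFieldType) (A : comAlgType K).

Lemma coef_prod_dpow (I : Type) (r : seq I) (y : I -> A) N n : (n <= N)%N ->
  (\prod_(j <- r) \poly_(k < N.+1) dpow (y j) k)`_n = dpow (\sum_(j <- r) y j)
    n.
Proof.
elim: r n => [|j r IHr] n nN; first by rewrite !big_nil dpow_0 coef1.
rewrite !big_cons coefM dpowD; apply: eq_bigr => k _.
have kn : (k <= n)%N by rewrite -ltnS.
by rewrite coef_poly ltnS (leq_trans kn nN) IHr // (leq_trans _ nN) // leq_subr.
Qed.

Lemma sum_bmultinom_ffun (V : nmodType) s N (G : ('I_s -> nat) -> V) n : (n <=
  N)%N ->
  (forall b b', b =1 b' -> G b = G b') ->
  \sum_(b : 'X_{1..s < N.+1} | mdeg b == n) G b =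
  \sum_(f : {ffun 'I_s -> 'I_N.+1} | (\sum_j f j == n)%N) G (fun j => f j).
Proof.
move=> nN Gext.
have le_mdeg (b : 'X_{1..s < N.+1}) j : (b j <= N)%N.
  by rewrite -ltnS (leq_ltn_trans _ (bmdeg b)) // mdegE (bigD1 j) //= leq_addr.
pose h (b : 'X_{1..s < N.+1}) : {ffun 'I_s -> 'I_N.+1} := [ffun j => inord (b
  j)].
pose h' (f : {ffun 'I_s -> 'I_N.+1}) : 'X_{1..s < N.+1} :=
  insubd bm0 [multinom (f j : nat) | j < s].
have h'E (f : {ffun 'I_s -> 'I_N.+1}) : (\sum_j f j)%N = n -> forall j, h' f j
  = f j.
  move=> fn j; rewrite val_insubd mdegE.
  by under eq_bigr do rewrite mnmE; rewrite fn ltnS nN mnmE.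
rewrite [RHS](reindex_onto h h') => [|f /eqP fn]; last first.
  by apply/ffunP => j; rewrite ffunE h'E // inord_val.
have hE b j : h b j = b j :> nat by rewrite ffunE inordK // ltnS le_mdeg.
apply: eq_big => [b|b _]; last by apply: Gext => j; rewrite hE.
under [in RHS]eq_bigr do rewrite hE; rewrite -mdegE.
have [bn|//] := eqVneq (mdeg b) n; apply/esym/eqP/val_inj/mnmP => j.
by rewrite h'E ?hE //; under eq_bigr do rewrite hE; rewrite -mdegE.
Qed.

(** The multinomial theorem, degree by degree. The right side depends on the [y j] only through
    their sum, which permits a change of variables. *)
Lemma sum_multinom_dpow s (y : 'I_s -> A) N :
  \sum_(b : 'X_{1..s < N.+1}) \prod_j dpow (y j) (b j) =
  \sum_(n < N.+1) dpow (\sum_j y j) n.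
Proof.
rewrite (partition_big (fun b : 'X_{1..s < N.+1} => Ordinal (bmdeg b)) predT)
  //=.
apply: eq_bigr => n _; have nN : (n <= N)%N by rewrite -ltnS.
rewrite -(coef_prod_dpow _ y nN).
under eq_bigl => b do rewrite -val_eqE /=.
rewrite (sum_bmultinom_ffun (G := fun b => \prod_j dpow (y j) (b j))) //;
  last first.
  by move=> b b' bb'; apply: eq_bigr => j _; rewrite bb'.
under [in RHS]eq_bigr => j _ do rewrite poly_def.
rewrite bigA_distr_bigA /= coef_sum big_mkcond; apply: eq_bigr => f _.
have -> : \prod_j (dpow (y j) (f j) *: 'X^(f j)) =
    (\prod_j dpow (y j) (f j)) *: 'X^(\sum_j f j) :> {poly A}.
  by rewrite scaler_prod prodrXr.
by rewrite coefZ coefXn eq_sym; case: eqP; rewrite ?mulr1 ?mulr0.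
Qed.

End Multinomial.

Section ExponentialSubstitution.
Variable K : numFieldType.

(** Over [rat] this is [exp_coef] by conversion. *)
Definition ecoef (c : K) (k : nat) : K := c ^+ k / k`!%:R.

Lemma dpowZ (A : comAlgType K) (c : K) (y : A) k : dpow (c *: y) k = ecoef c k
  *: y ^+ k.
Proof. by rewrite /dpow exprZn scalerA mulrC. Qed.

(** Substituting the L_j into the product of the e^(v_j y_j) gives the exponential of the sum of the
    v_j L_j, which is then regrouped by the variables x_k. *)
Lemma msubst_ecoef s r (L : 'I_s -> {mpoly K[r]}) (l : 'I_s -> 'I_r -> K)
    (v : 'I_s -> K) (a : 'X_{1..r}) :
  (forall j, L j = \sum_k l j k *: 'X_k) ->
  \sum_(b : 'X_{1..s < (mdeg a).+1})
     (\prod_(j < s) L j ^+ b j)@_a * \prod_(j < s) ecoef (v j) (b j) =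
  \prod_(k < r) ecoef (\sum_j v j * l j k) (a k).
Proof.
move=> LE; pose y j := v j *: L j.
transitivity (\sum_(b : 'X_{1..s < (mdeg a).+1}) \prod_j dpow (y j) (b j))@_a.
  rewrite raddf_sum /=; apply: eq_bigr => b _.
  under [in RHS]eq_bigr => j _ do rewrite dpowZ.
  by rewrite scaler_prod mcoeffZ mulrC.
pose z k := (\sum_j v j * l j k) *: ('X_k : {mpoly K[r]}).
have yz : \sum_j y j = \sum_k z k.
  rewrite /y /z; under eq_bigr => j _ do rewrite LE scaler_sumr.
  rewrite exchange_big; apply: eq_bigr => k _; rewrite scaler_suml.
  by apply: eq_bigr => j _; rewrite scalerA.
(* Both sums are the same truncated exponential of one linear form; after regrouping, only [b = a]
   contributes to x^a. *)
rewrite sum_multinom_dpow yz -sum_multinom_dpow raddf_sum /=.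
have zE (b : 'X_{1..r}) : \prod_k dpow (z k) (b k) =
    (\prod_k ecoef (\sum_j v j * l j k) (b k)) *: 'X_[b].
  by under eq_bigr => k _ do rewrite dpowZ; rewrite scaler_prod -mpolyXE_id.
have aa : (mdeg a < (mdeg a).+1)%N by [].
rewrite (bigD1 (BMultinom aa)) //= zE mcoeffZ mcoeffX eqxx mulr1 [X in _ +
  X]big1 ?addr0 //.
move=> b ba; rewrite zE mcoeffZ mcoeffX.
by rewrite (_ : bmnm b == a = false) ?mulr0 //; apply: contraNF ba => /eqP ba;
  apply/eqP/val_inj.
Qed.

Lemma fps_sumE (I : Type) (rI : seq I) (P : pred I) (F : I -> fps K) m :
  (\sum_(x <- rI | P x) F x) m = \sum_(x <- rI | P x) F x m.
Proof. by apply: (big_morph (fun f : fps K => f m)). Qed.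

Lemma fps_scaleE (x : K) (f : fps K) m : (x *: f) m = x * f m.
Proof. by []. Qed.

(** A linear substitution acts on a sum of exponentials by the transposed matrix on the exponents.
    It serves for the block sums in [hser], the differences in [gsh_gen] and the scaling in
    [gsh_coef]. *)
Lemma msubst_expsum s r (L : 'I_s -> {mpoly K[r]}) (l : 'I_s -> 'I_r -> K)
    (I : Type) (xs : seq I) (P : pred I) (kappa : I -> K) (v : I -> 'I_s -> K)
    (F : mps (fps K) s) m :
  (forall j, L j = \sum_k l j k *: 'X_k) ->
  (forall b, F b m = \sum_(x <- xs | P x) kappa x * \prod_j ecoef (v x j) (b
    j)) ->
  forall a, msubst L F a m =
    \sum_(x <- xs | P x) kappa x * \prod_k ecoef (\sum_j v x j * l j k) (a k).
Proof.
move=> LE FE a; rewrite /msubst fps_sumE.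
under eq_bigr => b _ do rewrite fps_scaleE FE mulr_sumr.
rewrite exchange_big; apply: eq_bigr => x _;
  rewrite -(msubst_ecoef _ _ LE) mulr_sumr.
by apply: eq_bigr => b _; rewrite mulrCA.
Qed.

End ExponentialSubstitution.

(** * The series g_sh as a sum over multisets *)

Lemma multisetsSP M r s :
  reflect (s \in multisets M r \/ exists i s',
             [/\ (i < r)%N, s' \in multisets M (r - i.+1) & s = (M.+1, i.+1) ::
               s'])
          (s \in multisets M.+1 r).
Proof.
rewrite mem_cat -/multisets; apply: (iffP orP) => -[sM|].
- by left.
- move=> /flattenP[_ /mapP[i + ->] /mapP[s' s'M ->]].
  by rewrite mem_iota => /andP[_ ir]; right; exists i, s'.
- by left.
- move=> [i [s' [ir s'M ->]]]; right; apply/flattenP.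
  exists (map (cons (M.+1, i.+1)) (multisets M (r - i.+1))); last exact: map_f.
  by apply/mapP; exists i; rewrite ?mem_iota.
Qed.

Lemma mem_multisets M r s : (s \in multisets M r) =
  [&& path gtn M.+1 (unzip1 s), all (fun p => 0 < p.1)%N s,
      all (fun p => 0 < p.2)%N s & sumn (unzip2 s) == r].
Proof.
elim: M r s => [|M IHM] r s.
  by case: s r => [|[[|x] y] s] [|r] //=; rewrite ?andbF ?inE.
apply/multisetsSP/idP => [[|[i [s' [ir + ->]]]]|].
- rewrite IHM => /and4P[+ -> -> ->]; rewrite !andbT.
  by case: s => //= p s /andP[pM ->]; rewrite ltnS ltnW.
- rewrite IHM /= ltnSn => /and4P[-> -> -> /eqP->]. by rewrite subnKC //= eqxx.
case: s => [|[x [//|y]] s]; first by left; rewrite IHM.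
  by rewrite /= !andbF.
rewrite /= !ltnS => /and4P[/andP[xM ps] /andP[x0 s1] s2 /eqP yr].
move: xM; rewrite leq_eqVlt => /orP[/eqP xM|xM].
  right; exists y, s; rewrite xM in ps *; split=> //;
    first by rewrite -yr leq_addr.
  by rewrite IHM ps s1 s2 -yr addKn eqxx.
by left; rewrite IHM /= xM ps x0 s1 s2 yr eqxx.
Qed.

Lemma multisets_uniq M r : uniq (multisets M r).
Proof.
elim: M r => [|M IHM] r; first by case: r.
rewrite /= cat_uniq IHM /=; apply/andP; split.
  apply/hasPn => s /flattenP[_ /mapP[i _ ->] /mapP[s' _ ->]].
  by rewrite mem_multisets /= ltnn.
elim: (iota 0 r) (iota_uniq 0 r) => //= i l IHl /andP[il ul].
rewrite cat_uniq IHl // map_inj_uniq ?IHM; last by move=> ? ? [].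
rewrite andbT; apply/hasPn => s /flattenP[_ /mapP[j jl ->] /mapP[s' _ ->]].
by apply/mapP => -[s'' _ [ij _]]; rewrite -ij jl in il.
Qed.

(** * Compositions with increasing indices as multisets *)

Section Compositions.
Variables (M r : nat).

(** Reversed because the indices of [Hser] increase while [multisets] lists elements in decreasing
    order. *)
Let pairs k (x : {ffun 'I_k -> 'I_r.+1} * {ffun 'I_k -> 'I_M.+1}) : seq (nat *
  nat) :=
  rev [seq (x.2 j : nat, x.1 j : nat) | j <- enum 'I_k].

Let unzip1_pairs k i u :
  unzip1 (@pairs k (i, u)) = rev [seq (u j : nat) | j <- enum 'I_k].
Proof. by rewrite /unzip1 map_rev -(map_comp fst). Qed.

Let unzip2_pairs k i u :
  unzip2 (@pairs k (i, u)) = rev [seq (i j : nat) | j <- enum 'I_k].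
Proof. by rewrite /unzip2 map_rev -(map_comp snd). Qed.

Let all_map_enum (T : Type) (P : pred T) k (f : 'I_k -> T) :
  all P [seq f j | j <- enum 'I_k] = [forall j, P (f j)].
Proof.
rewrite all_map; apply/allP/forallP => Pf j; first by apply: Pf;
  rewrite mem_enum.
by move=> _; exact: Pf.
Qed.

Let mem_pairs k i u : (@pairs k (i, u) \in multisets M r) =
  [forall j, 0 < i j]%N && (\sum_j i j == r)%N && ([forall j, (0 < u j)%N]
    && [forall j : 'I_k, forall l : 'I_k, (j < l)%N ==> (u j < u l)%N]).
Proof.
rewrite mem_multisets path_sortedE; last by move=> x y z /= yx zy;
  exact: ltn_trans zy yx.
rewrite -(all_map fst (fun n => 0 < n)%N) -(all_map snd (fun n => 0 < n)%N).
rewrite -/(unzip1 _) -/(unzip2 _) unzip1_pairs unzip2_pairs !all_rev sumn_rev.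
rewrite rev_sorted !all_map_enum sorted_map_enum; last by move=> x y z;
  exact: ltn_trans.
rewrite sumnE big_map big_enum /=.
rewrite (_ : [forall j, gtn M.+1 (u j)]); last by apply/forallP => j;
  exact: ltn_ord.
by case: [forall j, _]; case: [forall j, _]; case: [forall j, _];
  case: (_ == r).
Qed.

Let pairs_surj k s : s \in multisets M r -> size s = k -> exists x, s = @pairs
  k x.
Proof.
rewrite mem_multisets path_sortedE; last by move=> x y z /= yx zy;
  exact: ltn_trans zy yx.
move=> /and4P[/andP[/allP sM _] _ _ /eqP sr] sk.
have s1 j : (nth 0%N (unzip1 (rev s)) j < M.+1)%N.
  have [jk|kj] := ltnP j (size s);
    last by rewrite nth_default // size_map size_rev.
  by apply: sM; rewrite -mem_rev -map_rev mem_nth // size_map size_rev.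
have s2 j : (nth 0%N (unzip2 (rev s)) j < r.+1)%N.
  have [jk|kj] := ltnP j (size s);
    last by rewrite nth_default // size_map size_rev.
  rewrite ltnS -sr -sumn_rev -map_rev sumnE.
  by rewrite (big_nth 0%N) big_mkord size_map size_rev (bigD1 (Ordinal jk)) //=
    leq_addr.
exists ([ffun j : 'I_k => inord (nth 0%N (unzip2 (rev s)) j)],
        [ffun j : 'I_k => inord (nth 0%N (unzip1 (rev s)) j)]).
apply: (can_inj revK); rewrite /pairs revK.
apply: (eq_from_nth (x0 := (0%N, 0%N))) => [|j].
  by rewrite size_rev size_map size_enum_ord.
rewrite size_rev sk => jk; rewrite (nth_map (Ordinal jk)) ?size_enum_ord //=.
rewrite !ffunE !inordK // !(nth_map (0%N, 0%N)) ?size_rev ?sk ?(nth_enum_ord _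
  jk) //.
by case: (nth _ _ _).
Qed.

(** A multiset is its set of elements [u] with the composition [i] of [r] formed by their
    multiplicities; [k] is the number of distinct elements. *)
Lemma sum_compositions (V : nmodType) (F : seq (nat * nat) -> V) :
  \sum_(k < r.+1)
    \sum_(i : {ffun 'I_k -> 'I_r.+1} | [forall j, 0 < i j]%N && (\sum_j i j ==
      r)%N)
    \sum_(u : {ffun 'I_k -> 'I_M.+1} | [forall j, (0 < u j)%N]
       && [forall j : 'I_k, forall l : 'I_k, (j < l)%N ==> (u j < u l)%N])
       F (rev [seq (u j : nat, i j : nat) | j <- enum 'I_k]) =
  \sum_(s <- multisets M r) F s.
Proof.
have size_le s : s \in multisets M r -> (size s < r.+1)%N.
  rewrite mem_multisets ltnS => /and4P[_ _ + /eqP<-].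
  by elim: s => //= -[x y] s IHs /andP[/= y0 /IHs]; rewrite -add1n;
    exact: leq_add.
rewrite [RHS]big_seq (partition_big (fun s => inord (size s) : 'I_r.+1) predT)
  //=.
apply: eq_bigr => k _; rewrite pair_big -[LHS]big_filter -[RHS]big_filter.
rewrite (eq_bigr (F \o @pairs k)) // -(big_map (@pairs k) predT F).
apply: perm_big; apply: uniq_perm.
- rewrite map_inj_uniq ?filter_uniq ?index_enum_uniq // => -[i u] [i' u'].
  move=> /(can_inj revK)/eq_in_map iu; congr (_, _); apply/ffunP => j;
    by have [] := iu j (mem_enum _ _); move=> *; apply/val_inj.
- by rewrite filter_uniq ?multisets_uniq.
move=> s; rewrite mem_filter; apply/mapP/idP => [[[i u]]|].
  rewrite mem_filter -mem_pairs => /andP[sM _ ->].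
  by rewrite sM size_rev size_map -cardE card_ord inord_val eqxx.
move=> /andP[/andP[sM /eqP sk] _].
have [|[i u] sE] := @pairs_surj k s sM; first by rewrite -sk inordK ?size_le.
by exists (i, u) => //; rewrite mem_filter -mem_pairs -sE sM mem_index_enum.
Qed.

End Compositions.

(** The double inequality selects the block containing position [k]; past the end both sides are 0,
    the default of [nth]. *)
Lemma sum_block (i u : nat -> nat) n k :
  (\sum_(j < n) u j * (\sum_(l < j) i l <= k < \sum_(l < j.+1) i l) =
   nth 0 (flatten [seq nseq (i j) (u j) | j <- iota 0 n]) k)%N.
Proof.
elim: n => [|n IHn]; first by rewrite big_ord0 nth_nil.
have sz : size (flatten [seq nseq (i j) (u j) | j <- iota 0 n]) = (\sum_(l < n)
  i l)%N.
  rewrite size_flatten /shape -map_comp sumnE big_map -[in iota 0 n](subn0 n).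
  by rewrite -/(index_iota 0 n) big_mkord; apply: eq_bigr => j _;
    rewrite /= size_nseq.
have -> : iota 0 n.+1 = iota 0 n ++ [:: n] by rewrite -addn1 iotaD.
rewrite big_ord_recr IHn map_cat flatten_cat nth_cat sz /= cats0.
have [kn|nk] := ltnP k (\sum_(l < n) i l); first by rewrite muln0 addn0.
rewrite nth_default ?sz // add0n nth_nseq big_ord_recr /= ltn_subLR //.
by case: ifP; rewrite ?muln1 ?muln0.
Qed.

Definition qfrac (u : nat) : fps rat := fpsX ^+ u / (1 - fpsX ^+ u).

Lemma rev_expand (s : seq (nat * nat)) :
  rev (expand s) = flatten [seq nseq p.2 p.1 | p <- rev s].
Proof.
rewrite /expand rev_flatten -map_comp map_rev; congr (flatten (rev _)).
by apply: eq_map => p /=; rewrite rev_nseq.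
Qed.

Lemma Hser_expsum r (n : 'I_r -> nat) (b : 'X_{1..r}) m :
  Hser n b m = \sum_(u : {ffun 'I_r -> 'I_m.+1} | [forall j, (0 < u j)%N]
       && [forall j : 'I_r, forall l : 'I_r, (j < l)%N ==> (u j < u l)%N])
    (\prod_j qfrac (u j) ^+ n j) m * \prod_j ecoef ((u j)%:R : rat) (b j).
Proof.
rewrite /Hser fps_sumE; apply: eq_bigr => u _.
by rewrite scaler_prod fps_scaleE mulrC.
Qed.

(** Substituting block sums gives x_k the exponent of its block, an entry of the increasing
    expansion by [sum_block]; the 1/i! turn powers into divided powers. As in [Hser], [m] is both
    the coefficient index and the bound on the elements. *)
Lemma hser_expsum r (b : 'X_{1..r}) m :
  hser b m = \sum_(s <- multisets m r) multiset_weight (K := rat) qfrac s m *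
    \prod_(k < r) ecoef ((nth 0%N (rev (expand s)) k)%:R : rat) (b k).
Proof.
rewrite -sum_compositions /hser fps_sumE; apply: eq_bigr => k _.
rewrite fps_sumE; apply: eq_bigr => i _; rewrite fps_scaleE.
pose l (j : 'I_k) (x : 'I_r) : rat := (\sum_(l < k | (l < j)%N) i l <= x
                            < \sum_(l < k | (l <= j)%N) i l)%N%:R.
rewrite (msubst_expsum (l := l) _ (fun b => Hser_expsum _ b m)) => [|j];
  last first.
  rewrite big_mkcond; apply: eq_bigr => x _; rewrite /l.
  by case: ifP; rewrite ?scale1r ?scale0r.
rewrite mulr_sumr; apply: eq_bigr => u _; rewrite mulrA.
congr (_ * _).
  rewrite -fps_scaleE; congr (_ m).
  rewrite /multiset_weight big_rev big_map big_enum /=.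
  rewrite -prodfV -scaler_prod; apply: eq_bigr => j _; by [].
apply: eq_bigr => x _; congr (ecoef _ _).
rewrite rev_expand revK -map_comp.
pose i' j := nth 0%N [seq (i x : nat) | x <- enum 'I_k] j.
pose u' j := nth 0%N [seq (u x : nat) | x <- enum 'I_k] j.
have i'E j : i' (nat_of_ord j) = i j.
  by rewrite /i' (nth_map j) ?size_enum_ord // nth_ord_enum.
have u'E j : u' (nat_of_ord j) = u j.
  by rewrite /u' (nth_map j) ?size_enum_ord // nth_ord_enum.
have -> : [seq nseq (i j) (u j : nat) | j <- enum 'I_k] = [seq nseq (i' j) (u'
  j) | j <- iota 0 k].
  by rewrite -val_enum_ord -map_comp; apply: eq_map => j /=; rewrite i'E u'E.
rewrite -sum_block natr_sum; apply: eq_bigr => j _.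
rewrite natrM u'E /l (big_ord_widen k i') ?(ltnW (ltn_ord j)) //.
rewrite (big_ord_widen k i') ?ltn_ord //.
under eq_bigr => y _ do rewrite -i'E;
  under [in X in (_ <= _ < X)%N]eq_bigr => y _ do rewrite -i'E.
by [].
Qed.

Lemma size_expand M r s : s \in multisets M r -> size (expand s) = r.
Proof.
rewrite mem_multisets => /and4P[_ _ _ /eqP <-].
rewrite size_flatten /shape -map_comp; congr sumn.
by apply: eq_map => p /=; rewrite size_nseq.
Qed.

Lemma sum_ord_delta (V : pzRingType) r (f : nat -> V) (n : nat) :
  \sum_(j < r) f j * (n == j :> nat)%:R = if (n < r)%N then f n else 0.
Proof.
case: ifP => [nr|/negbT nr].
  rewrite (bigD1 (Ordinal nr)) //= eqxx mulr1 big1 ?addr0 // => j jn.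
  by rewrite (_ : (n == j :> nat) = false) ?mulr0 // eq_sym; apply: negPf.
rewrite big1 // => j _; rewrite (_ : (n == j :> nat) = false) ?mulr0 //.
by apply: contraNF nr => /eqP->.
Qed.

(** The transposed substitution turns the exponents into consecutive differences of the decreasing
    expansion; the default 0 of [nth] is the missing entry u_(r+1). *)
Lemma gsh_gen_expsum r (a : 'X_{1..r}) m :
  gsh_gen a m = \sum_(s <- multisets m r) multiset_weight (K := rat) qfrac s m *
    \prod_(k < r) ecoef ((nth 0%N (expand s) k)%:R - (nth 0%N (expand s)
      k.+1)%:R : rat) (a k).
Proof.
pose l (j k : 'I_r) : rat := (k == rev_ord j :> nat)%:R - (k.+1 == rev_ord j :>
  nat)%:R.
rewrite /gsh_gen.
rewrite (msubst_expsum (l := l) _ (fun b => hser_expsum b m)) => [|j];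
  last first.
  rewrite /l; under [RHS]eq_bigr => k _ do rewrite scalerBl.
  rewrite sumrB; congr (_ - _).
    rewrite (bigD1 (rev_ord j)) //= eqxx scale1r big1 ?addr0 // => k kj.
    by rewrite (_ : (k == r - j.+1 :> nat)%N = false) ?scale0r //;
      exact: negbTE.
  rewrite big_mkcond; apply: eq_bigr => k _ /=.
  by case: ifP; rewrite ?scale1r ?scale0r.
rewrite big_seq [RHS]big_seq; apply: eq_bigr => s /size_expand sz.
congr (_ * _); apply: eq_bigr => k _; congr (ecoef _ _).
rewrite (reindex_inj rev_ord_inj) /=.
transitivity (\sum_(j < r) (nth 0%N (expand s) j)%:R * ((k == j :> nat)%:R -
  (k.+1 == j :> nat)%:R) : rat).
  apply: eq_bigr => j _; rewrite /l rev_ordK nth_rev ?sz //;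
    last by rewrite rev_ord_proof.
  by rewrite subnSK // subKn // ltnW.
under eq_bigr => j _ do rewrite mulrBr.
rewrite sumrB; have dE := sum_ord_delta r (fun j => (nth 0%N (expand s) j)%:R :
  rat).
rewrite (dE k) (dE k.+1) ltn_ord.
by case: (ltnP k.+1 r) => // rk; rewrite (@nth_default _ _ _ k.+1) ?sz.
Qed.

Section FpsMap.
Variables (R S : comNzRingType) (phi : {rmorphism R -> S}).

Definition fps_mapr : fps R -> fps S := fps_map phi.

Fact fps_mapr_additive : {morph fps_mapr : f g / f - g}.
Proof. by move=> f g; apply/funext => m; rewrite [LHS]rmorphB. Qed.

Fact fps_mapr_multiplicative : monoid_morphism fps_mapr.
Proof.
split; first by apply/funext => m; rewrite [LHS]rmorph_nat.
move=> f g; apply/funext => m; rewrite [LHS]rmorph_sum.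
by apply: eq_bigr => k _; rewrite rmorphM.
Qed.

HB.instance Definition _ :=
  GRing.isZmodMorphism.Build (fps R) (fps S) fps_mapr fps_mapr_additive.
HB.instance Definition _ :=
  GRing.isMonoidMorphism.Build (fps R) (fps S) fps_mapr fps_mapr_multiplicative.

End FpsMap.

Lemma ratr_ecoef (K : numFieldType) (c : rat) k : ratr (ecoef c k) = ecoef
  (ratr c : K) k.
Proof. by rewrite /ecoef rmorphM rmorphXn fmorphV rmorph_nat. Qed.

Lemma fps_map_dpow (K : numFieldType) (f : fps rat) n :
  fps_map ratr (dpow f n) = dpow (fps_map ratr f : fps K) n.
Proof.
rewrite -[fps_map ratr f]/(fps_mapr ratr f) /dpow -rmorphXn; apply/funext => m.
by rewrite /fps_map !fps_scaleE rmorphM fmorphV rmorph_nat.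
Qed.

Lemma fps_map_weight (K : numFieldType) (t : nat -> fps rat) s :
  fps_map ratr (multiset_weight t s) =
  multiset_weight (fun u => fps_map ratr (t u) : fps K) s.
Proof.
rewrite -[LHS]/(fps_mapr ratr _) /multiset_weight rmorph_prod.
by apply: eq_bigr => p _; exact: fps_map_dpow.
Qed.

(** The last factor reads [w] past its end, where the default 0 gives the gap down to 0. *)
Lemma gap_coef_prod (K : numFieldType) (A : comAlgType K) (c : K) p a0 a w :
  size a = size w ->
  gap_coef (c%:A : A) p a0 a w = (\prod_(k < (size w).+1)
    ecoef (((nth 0%N (p :: w) k)%:R - (nth 0%N w k)%:R) * c) (nth 0%N (a0 :: a)
      k))%:A.
Proof.
have natA q : q%:R = q%:R%:A :> A by rewrite scaler_nat.
have dpowA (x : K) n : dpow (x%:A * c%:A : A) n = (ecoef (x * c) n)%:A.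
  by rewrite mulr_algl scalerA dpowZ expr1n.
elim: a p a0 w => [|a1 a IHa] p a0 [|w1 w] //= => [_|[sz]].
  by rewrite big_ord1 /= subr0 natA dpowA.
by rewrite big_ord_recl IHa //= !natA -scalerBl dpowA mulr_algl scalerA.
Qed.

(** * Coefficients of g^sh from the ordered product *)

Section GshCoef.
Variable R : realType.

Definition minus_2pi_i : R[i] := ((- 2 * @trigo.pi R)%:C * 'i)%C.

Definition qfracC (u : nat) : fps R[i] := fps_map ratr (qfrac u).

Lemma gsh_coef_ordered_exp ns m :
  gsh_coef R ns m =
  ordered_exp qfracC minus_2pi_i%:A m (block_word 0 (map predn ns)) m.
Proof.
rewrite ordered_exp_block fps_sumE size_map /gsh_coef.
pose l (j k : 'I_(size ns)) : R[i] := minus_2pi_i * (k == j)%:R.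
pose v (s : seq (nat * nat)) (k : 'I_(size ns)) : R[i] :=
  (nth 0%N (expand s) k)%:R - (nth 0%N (expand s) k.+1)%:R.
have FE (b : 'X_{1..size ns}) : fps_map ratr (gsh_gen b) m =
    \sum_(s <- multisets m (size ns)) multiset_weight qfracC s m * \prod_j
      ecoef (v s j) (b j).
  rewrite (_ : fps_map _ _ _ = ratr (gsh_gen b m)) // gsh_gen_expsum rmorph_sum.
  apply: eq_bigr => s _.
  rewrite rmorphM rmorph_prod -fps_map_weight; congr (_ * _).
  by apply: eq_bigr => k _; rewrite [LHS]ratr_ecoef rmorphB !rmorph_nat.
rewrite (msubst_expsum (l := l) _ FE) => [|j]; last first.
  rewrite (bigD1 j) //= /l eqxx mulr1 big1 ?addr0 // => k /negPf kj.
  by rewrite kj mulr0 scale0r.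
rewrite big_seq [RHS]big_seq; apply: eq_bigr => s /size_expand sz.
rewrite gap_coef_prod ?sz ?size_map // mulr_algr fps_scaleE mulrC;
  congr (_ * _).
(* The word has no leading zeros, so the factor of the first gap has exponent 0. *)
rewrite big_ord_recl [ecoef _ _](_ : _ = 1) ?mul1r;
  last by rewrite /ecoef /= invr1 mulr1.
apply: eq_bigr => k _.
rewrite mnmE /= (nth_map 0%N) ?add0n //; congr (ecoef _ _).
rewrite (bigD1 k) //= /l eqxx mulr1 big1 ?addr0 // => j /negPf jk.
by rewrite eq_sym jk !mulr0.
Qed.

End GshCoef.

(** * The limit character *)

Section Truncation.
Variable K : comNzRingType.
Implicit Types x y : fps K.

(** Congruence modulo q^N. *)
Definition eqmod N x y := forall k, (k < N)%N -> x k = y k.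

Lemma fps_mulE x y m : (x * y) m = \sum_(k < m.+1) x k * y (m - k)%N.
Proof. by []. Qed.

Lemma eqmodM N x x' y y' : eqmod N x x' -> eqmod N y y' -> eqmod N (x * y) (x'
  * y').
Proof.
move=> xx yy m mN; rewrite !fps_mulE; apply: eq_bigr => k _.
by rewrite xx ?yy // (leq_ltn_trans _ mN) ?leq_subr // -ltnS.
Qed.

Lemma eqmodX N x y n : eqmod N x y -> eqmod N (x ^+ n) (y ^+ n).
Proof. by move=> xy; elim: n => // n IHn; rewrite !exprS; exact: eqmodM. Qed.

Lemma eqmodZ N (a : K) x y : eqmod N x y -> eqmod N (a *: x) (a *: y).
Proof. by move=> xy k kN; rewrite -[LHS]/(a * x k) xy. Qed.

Variable T : eqType.
Implicit Types (f g : seq T -> fps K) (F G : nat -> seq T -> fps K).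

Lemma eqmod_conv N f f' g g' :
  (forall w, eqmod N (f w) (f' w)) -> (forall w, eqmod N (g w) (g' w)) ->
  forall w, eqmod N (conv f g w) (conv f' g' w).
Proof.
move=> ff gg w k kN; rewrite /conv.
do 2!rewrite (big_morph (fun h : fps K => h k) (id1 := 0) (op1 := +%R)) //.
by apply: eq_bigr => i _; apply: eqmodM.
Qed.

Definition stable F := forall M w, eqmod M.+1 (F M.+1 w) (F M w).

(** The q-adic limit of a stable sequence: the coefficient of q^m is constant from stage [m] on. *)
Definition diagonal F : seq T -> fps K := fun w m => F m w m.

Lemma eqmod_diagonal F M w : stable F -> eqmod M.+1 (diagonal F w) (F M w).
Proof.
move=> sF k; rewrite ltnS => kM; rewrite /diagonal -(subnK kM).
by elim: (M - k)%N => //= d IHd; rewrite IHd sF // ltnS leq_addl.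
Qed.

Lemma diagonal_char F : stable F -> (forall M, shuffle_char (F M)) ->
  shuffle_char (diagonal F).
Proof.
move=> sF cF; split=> [|u v]; apply/funext => m.
  by rewrite /diagonal (cF m).1.
rewrite (eqmodM (eqmod_diagonal (M := m) u sF) (eqmod_diagonal (M := m) v sF))
  // (cF m).2.
rewrite /shsum; do 2!rewrite (big_morph (fun h : fps K => h m) (id1 := 0) (op1
  := +%R)) //.
Qed.

Lemma conv_diagonal F G : stable F -> stable G ->
  (forall M w, conv (F M) (G M) w = conv_unit _ w) ->
  forall w, conv (diagonal F) (diagonal G) w = conv_unit _ w.
Proof.
move=> sF sG FG w; apply/funext => m; rewrite -(FG m).
by apply: (eqmod_conv (N := m.+1)) => // u; exact: eqmod_diagonal.
Qed.

End Truncation.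

(** * The infinite product and its inverse *)

Section InfiniteProduct.
Variables (K : numFieldType) (c : fps K) (t : nat -> fps K).
Hypothesis t_small : forall u, eqmod u (t u) 0.
Implicit Types (x : fps K) (w : seq bool).

(* The series e^(- u c e_0) exp (x e_1) e^(u c e_0). *)
Definition conj_exp (u : nat) x : seq bool -> fps K :=
  conv (expw false (- (u%:R * c))) (conv (expw true x) (expw false (u%:R * c))).

Lemma conj_exp_char u x : shuffle_char (conj_exp u x).
Proof. by do 2!(apply: conv_char; first exact: expw_char);
  exact: expw_char. Qed.

Let convAf (f g h : seq bool -> fps K) : conv f (conv g h) = conv (conv f g) h.
Proof. by apply/funext => w; exact: convA. Qed.

Let convDf b x y : conv (expw b x) (expw b y) = expw b (x + y) :> (seq bool ->
  fps K).
Proof. by apply/funext => w; exact: conv_expwD. Qed.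

Let conv1ff (f : seq bool -> fps K) : conv (@conv_unit _ _) f = f.
Proof. by apply/funext => w; exact: conv1f. Qed.

Let convf1f (f : seq bool -> fps K) : conv f (@conv_unit _ _) = f.
Proof. by apply/funext => w; exact: convf1. Qed.

Let expw0f b : expw b 0 = @conv_unit _ _ :> (seq bool -> fps K).
Proof. by apply/funext => w; exact: expw0. Qed.

Let conv_inner (f g g' h : seq bool -> fps K) : conv g g' = @conv_unit _ _ ->
  conv (conv f g) (conv g' h) = conv f h.
Proof. by move=> gg'; rewrite !convAf -(convAf f g) gg' convf1f. Qed.

Let conv_cancel (f g g' h h' k : seq bool -> fps K) : conv g g' = @conv_unit _
  _ ->
  conv (conv f (conv h g)) (conv g' (conv h' k)) = conv f (conv (conv h h') k).
Proof. by move=> gg'; rewrite !convAf -(convAf (conv f h) g) gg' convf1f. Qed.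

Let expwK b x : conv (expw b x) (expw b (- x)) = @conv_unit _ _ :> (seq bool ->
  fps K).
Proof. by rewrite (convDf b x (- x)) subrr expw0f. Qed.

Let expwVK b x : conv (expw b (- x)) (expw b x) = @conv_unit _ _ :> (seq bool
  -> fps K).
Proof. by rewrite (convDf b (- x) x) addNr expw0f. Qed.

Lemma conj_expD u x y : conv (conj_exp u x) (conj_exp u y) = conj_exp u (x + y).
Proof.
rewrite /conj_exp (conv_cancel _ _ _ _ (expwK false (u%:R * c))).
by rewrite (convDf true x y).
Qed.

Lemma conj_exp0 u : conj_exp u 0 = @conv_unit _ _.
Proof. by rewrite /conj_exp (expw0f true) conv1ff (expwVK false). Qed.

Fixpoint prod_exp (M : nat) : seq bool -> fps K :=
  if M is M'.+1 then conv (conj_exp M (t M)) (prod_exp M') else @conv_unit _ _.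

Fixpoint prod_exp_inv (M : nat) : seq bool -> fps K :=
  if M is M'.+1 then conv (prod_exp_inv M') (conj_exp M (- t M)) else
    @conv_unit _ _.

Lemma prod_exp_char M : shuffle_char (prod_exp M).
Proof.
elim: M => [|M IHM]; first exact: conv_unit_char.
by apply: conv_char => //; exact: conj_exp_char.
Qed.

Lemma prod_exp_inv_char M : shuffle_char (prod_exp_inv M).
Proof.
elim: M => [|M IHM]; first exact: conv_unit_char.
by apply: conv_char => //; exact: conj_exp_char.
Qed.

Lemma prod_expK M : conv (prod_exp M) (prod_exp_inv M) = @conv_unit _ _.
Proof.
elim: M => [|M IHM]; first exact: conv1ff.
by rewrite [LHS](conv_inner _ _ IHM) conj_expD subrr conj_exp0.
Qed.

Lemma prod_expVK M : conv (prod_exp_inv M) (prod_exp M) = @conv_unit _ _.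
Proof.
elim: M => [|M IHM]; first exact: conv1ff.
by rewrite [LHS](conv_inner _ _ _) // conj_expD addNr conj_exp0.
Qed.

Lemma eqmod_dpow N x y n : eqmod N x y -> eqmod N (dpow x n) (dpow y n).
Proof. by move=> xy; apply/eqmodZ/eqmodX. Qed.

Lemma eqmod_expw N b x y w : eqmod N x y -> eqmod N (expw b x w) (expw b y w).
Proof. by move=> xy; rewrite /expw; case: ifP => // _; exact: eqmod_dpow. Qed.

Lemma eqmod_conj_exp u x : eqmod u x 0 -> forall w, eqmod u (conj_exp u x w)
  (conv_unit _ w).
Proof.
move=> x0 w; rewrite -(conj_exp0 u); apply: eqmod_conv => v; first by [].
by apply: eqmod_conv => z; [exact: eqmod_expw|].
Qed.

(** The new factor is congruent to 1 modulo q^(M+1), by [t_small]. *)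
Lemma prod_exp_stable : stable prod_exp.
Proof.
move=> M w; rewrite -[in X in eqmod _ _ X](conv1ff (prod_exp M)).
by apply: eqmod_conv => // v; apply: eqmod_conj_exp.
Qed.

Lemma prod_exp_inv_stable : stable prod_exp_inv.
Proof.
move=> M w; rewrite -[in X in eqmod _ _ X](convf1f (prod_exp_inv M)).
apply: eqmod_conv => // v; apply: eqmod_conj_exp => k kM.
by rewrite -[LHS]/(- _) t_small // oppr0.
Qed.

(** The coefficient of a single letter is additive on products, and the two outer exponentials of
    [conj_exp] cancel. This is what kills I(0; 0; 1). *)
Lemma prod_exp_false M : prod_exp M [:: false] = 0.
Proof.
have conv_letter f g a : f [::] = 1 -> g [::] = 1 ->
    conv f g [:: a] = f [:: a] + g [:: a] :> fps K.
  by move=> f1 g1; rewrite conv_cons conv_nil f1 /= g1 mul1r mulr1 addrC.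
elim: M => //= M IHM;
  rewrite conv_letter ?(conj_exp_char _ _).1 ?(prod_exp_char _).1 //.
rewrite IHM addr0 /conj_exp !conv_letter ?(expw_char _ _).1 ?conv_nil
  ?(expw_char _ _).1 ?mulr1 //.
by rewrite /expw /= /dpow invr1 !scale1r !expr1 add0r addNr.
Qed.

Lemma prod_expE M :
  prod_exp M = conv (expw false (- (M%:R * c))) (ordered_exp t c M).
Proof.
elim: M => [|M IHM] /=; first by rewrite mul0r oppr0 expw0f conv1ff.
rewrite IHM /conj_exp -!convAf (convAf (expw false _) (expw false _)) convDf.
(* The inner exponentials of consecutive factors telescope. *)
have -> : M.+1%:R * c + - (M%:R * c) = c by rewrite -natr1; ring.
by [].
Qed.

(** The outer factor in [prod_expE] sees only leading zeros, and there are none. *)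
Lemma prod_exp_block M a :
  prod_exp M (block_word 0 a) = ordered_exp t c M (block_word 0 a).
Proof.
rewrite prod_expE conv_expw_nseq; last by case: a.
by rewrite big_ord1 dpow0 mul1r.
Qed.

End InfiniteProduct.

Lemma eqmod_Xn (K : comNzRingType) n : eqmod n (fpsX ^+ n : fps K) 0.
Proof.
elim: n => // n IHn k; rewrite ltnS => kn;
  rewrite exprS fps_mulE big_ord_recl mul0r add0r.
apply: big1 => i _; rewrite IHn ?mulr0 //= (leq_trans _ kn) //.
by rewrite ltn_subrL (leq_ltn_trans _ (ltn_ord i)).
Qed.

Lemma eqmod_qfracC (R : realType) u : eqmod u (qfracC R u) 0.
Proof.
move=> k ku; rewrite -[LHS]/(ratr (qfrac u k)).
have -> : qfrac u k = (0 * (1 - fpsX ^+ u)^-1 : fps rat) k.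
  exact: (eqmodM (eqmod_Xn _ (n := u))).
by rewrite mul0r rmorph0.
Qed.

(** * Existence, uniqueness and multiplicativity of the map *)

Lemma rmorphism_linear (K : numFieldType) (B : lalgType rat) (A : lalgType K)
    (g : {rmorphism B -> A}) : (forall c x, g (c *: x) = (ratr c)%:A * g x) ->
  exists h : {linear B -> A | ratr \; *:%R}, h =1 g.
Proof.
move=> gZ.
have sc : scalable_for (ratr \; *:%R) g by move=> a x; rewrite gZ mulr_algl.
pose h : {linear B -> A | ratr \; *:%R} :=
  HB.pack (g : B -> A)
    (GRing.isZmodMorphism.Build B A g (rmorphB g)) (GRing.isScalable.Build rat
      B A (ratr \; *:%R) g sc).
by exists h.
Qed.

Theorem theorem4p3 (R : realType) :
  exists g : {linear I1alg -> fps R[i] | ratr \; *:%R},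
    [/\ gsh_values g,
        forall g' : {linear I1alg -> fps R[i] | ratr \; *:%R},
          gsh_values g' -> g' =1 g
      & monoid_morphism g].
Proof.
pose c : fps R[i] := (minus_2pi_i R)%:A; pose t := qfracC R.
have t_small := @eqmod_qfracC R.
have st := prod_exp_stable c t_small; have st' := prod_exp_inv_stable c t_small.
pose chi := diagonal (prod_exp c t); pose chi' := diagonal (prod_exp_inv c t).
pose f : {rmorphism rat -> fps R[i]} := GRing.in_alg (fps R[i]) \o ratr.
have [//|||||g [gI gZ]] := @I1alg_lift _ f chi chi'.
- exact: diagonal_char st (prod_exp_char c t).
- exact: diagonal_char st' (prod_exp_inv_char c t).
- by apply: conv_diagonal => // M w; rewrite prod_expK.
- by apply: conv_diagonal => // M w; rewrite prod_expVK.
- by apply/funext => m; rewrite /chi /diagonal prod_exp_false.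
have [h hg] := rmorphism_linear gZ.
have hv : gsh_values h.
  move=> ns nsp; rewrite hg gI -[flatten _]/(idx_word ns).
  have -> : idx_word ns = block_word 0 (map predn ns).
    by rewrite /block_word /= -map_comp.
  (* The limit has the same coefficient of q^m as stage [m], the stage that appears in
     [gsh_coef_ordered_exp]. *)
  by apply/funext => m;
    rewrite gsh_coef_ordered_exp /chi /diagonal prod_exp_block.
exists h; split=> //; last first.
  by split=> [|x y]; rewrite !hg ?rmorph1 ?rmorphM.
(* Uniqueness: both maps are linear and agree on a spanning family. *)
move=> g' g'v x; have [s [/allP sp ->]] := idx_spanP x.
rewrite !linear_sum big_seq [RHS]big_seq; apply: eq_bigr => p ps.
by rewrite !linearZ g'v ?hv //; exact: sp.
Qed.
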